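(* Let $n\ge 1$, $1\le s\le n$, let $A_1,\dots,A_s\subset\mathbb Z^n$ be finite sets and let $m_1,\dots,m_s\ge 0$ be integers with $m_1+\cdots+m_s=n$. Assume that the mixed volume satisfies $V(\mathrm{conv}(A_1),m_1;\dots;\mathrm{conv}(A_s),m_s)\ge 1$. Let $b:A_1\sqcup\cdots\sqcup A_s\to\mathbb R$ be a lifting in general position, let $F_0\subset F_1\subset\cdots\subset F_n=\mathbb R^n$ be a generic affine flag, and let $(m_i(d))_{d=0,\dots,n}$, $i=1,\dots,s$, be sequences as described in the context. Then: (a) each set $X'_d$, $d=1,\dots,n$, is a finite closed union of line segments and half-lines; (b) $X_{d-1}=X'_d\cap F_{d-1}$ for $d=1,\dots,n$; (c) each connected component of $X'_d$ meets $F_{d-1}$ at least once; (d) (transversality) every point of $X'_d\cap F_{d-1}$ lies in the interior of a line segment or of a half-line contained in $X'_d$.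
   Context: For convex bodies $K_1,\dots,K_s\subset\mathbb R^n$ and nonnegative integers $m_1+\cdots+m_s=n$, $V(K_1,m_1;\dots;K_s,m_s)$ denotes the mixed volume $V(K_1,\dots,K_1,\dots,K_s,\dots,K_s)$ with $K_i$ repeated $m_i$ times, where the mixed volume of an $n$-tuple $(\mathcal K_1,\dots,\mathcal K_n)$ is $\frac{1}{n!}\frac{\partial^n}{\partial t_1\cdots\partial t_n}\mathrm{Vol}(t_1\mathcal K_1+\cdots+t_n\mathcal K_n)$ (at $t=0$, $t_i\ge0$). A lifting is a function $b:A_1\sqcup\cdots\sqcup A_s\to\mathbb R$, written $b(i,\mathbf a)$ for $\mathbf a\in A_i$. It is in general position if for every subset $S$ of $\{[-\mathrm e_i,\mathbf a,b(i,\mathbf a)]:1\le i\le s,\ \mathbf a\in A_i\}\subset\mathbb R^s\times\mathbb R^n\times\mathbb R$ of cardinality at most $n+s+1$, either the vectors of $S$ are linearly independent or $[0,\dots,0,1]$ is a linear combination of them ($\mathrm e_i$ the $i$-th canonical basis vector of $\mathbb R^s$). For $\boldsymbol\xi\in(\mathbb R^n)^*$ set $\lambda_i(\boldsymbol\xi)=\max_{\mathbf a\in A_i}(\boldsymbol\xi(\mathbf a)-b(i,\mathbf a))$ and let $m_i(\boldsymbol\xi)$ be such that this maximum is attained at exactly $m_i(\boldsymbol\xi)+1$ points $\mathbf a\in A_i$. The flag $F_0\subset\cdots\subset F_n$ consists of affine subspaces with $\dim F_d=d$. For each $i$, $(m_i(d))_{d=0,\dots,n}$ is a non-decreasing sequence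 of nonnegative integers with $m_i(0)=0$, $m_i(n)=m_i$, and $\sum_i m_i(d)=d$ for every $d$. Define $X_d=\{\boldsymbol\xi\in F_d: m_i(\boldsymbol\xi)\ge m_i(d)\ \forall i\}$ and $X'_d=\{\boldsymbol\xi\in F_d: m_i(\boldsymbol\xi)\ge m_i(d-1)\ \forall i\}$. *)

(* Defs.v *)
From HB Require Import structures.
From mathcomp Require Import all_boot all_order all_algebra finmap.
From mathcomp Require Import all_classical all_reals all_analysis.
Set Implicit Arguments. Unset Strict Implicit. Unset Printing Implicit Defensive.
Import Order.TTheory GRing.Theory Num.Theory.
Import numFieldNormedType.Exports.
Local Open Scope classical_set_scope.
Local Open Scope ring_scope.

Section Defs.
Variable R : realType.

(* n-dimensional Lebesgue volume, by iterated integration of sections  *)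
(* (the construction of product measures, cf. product_measure1).       *)
(* R^0 is a point: its volume is the counting measure.                  *)
Fixpoint vol (n : nat) : set 'rV[R]_n -> \bar R :=
  match n with
  | 0 => fun S => if `[< S !=set0 >] then 1%E else 0%E
  | n'.+1 => fun S =>
      (\int[lebesgue_measure]_x
          vol [set y : 'rV[R]_n' | S (row_mx (x%:M : 'rV[R]_1) y)])%E
  end.

Definition minkowski (n : nat) (Ks : seq (set 'rV[R]_n))
  (t : 'rV[R]_(size Ks)) : set 'rV[R]_n :=
  [set x | exists y : 'I_(size Ks) -> 'rV[R]_n,
      (forall j : 'I_(size Ks), (nth set0 Ks j) (y j)) /\ x = \sum_j t 0 j *: y j].

Definition rpartial (k : nat) (i : 'I_k) (f : 'rV[R]_k -> R) : 'rV[R]_k -> R :=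
  fun t => lim ((f (t + h *: delta_mx 0 i) - f t) / h @[h --> (0:R)^'+]).

Definition mixed_volume (n : nat) (Ks : seq (set 'rV[R]_n)) : R :=
  ((size Ks)`!%:R)^-1 *
  (foldr (fun (i : 'I_(size Ks)) (g : 'rV[R]_(size Ks) -> R) => rpartial i g)
         (fun t : 'rV[R]_(size Ks) => fine (vol (@minkowski n Ks t)))
         (enum 'I_(size Ks))) 0.

Definition mixed_volume_mult (n s : nat) (K : 'I_s -> set 'rV[R]_n)
  (m : 'I_s -> nat) : R :=
  mixed_volume (flatten [seq nseq (m i) (K i) | i <- enum 'I_s]).

Definition conv (n : nat) (P : seq 'rV[R]_n) : set 'rV[R]_n :=
  [set x | exists w : 'I_(size P) -> R,
     [/\ forall k, 0 <= w k, \sum_k w k = 1 & x = \sum_k w k *: P`_k]].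

Definition realpt (n : nat) (a : 'rV[int]_n) : 'rV[R]_n := map_mx intr a.

Definition conv_int (n : nat) (A : {fset 'rV[int]_n}) : set 'rV[R]_n :=
  conv [seq realpt a | a <- enum_fset A].

Definition lift_vec (n s : nat) (b : 'I_s -> 'rV[int]_n -> R)
  (q : 'I_s * 'rV[int]_n) : 'rV[R]_(s + n + 1) :=
  row_mx (row_mx (- delta_mx 0 q.1) (realpt q.2)) ((b q.1 q.2)%:M : 'rV[R]_1).

Definition last_vec (k : nat) : 'rV[R]_(k + 1) := row_mx 0 (1%:M : 'rV[R]_1).

Definition general_position (n s : nat) (A : 'I_s -> {fset 'rV[int]_n})
  (b : 'I_s -> 'rV[int]_n -> R) : Prop :=
  forall S : seq ('I_s * 'rV[int]_n),
    uniq S -> all (fun q => q.2 \in A q.1) S -> (size S <= n + s + 1)%N ->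
    free [seq lift_vec b q | q <- S]
    \/ (last_vec (s + n) \in <<[seq lift_vec b q | q <- S]>>%VS).

(* xi(a) for xi in the dual space (identified with row vectors) *)
Definition pairing (n : nat) (xi : 'rV[R]_n) (a : 'rV[int]_n) : R :=
  \sum_k xi 0 k * (a 0 k)%:~R.

Definition nmax (n s : nat) (A : 'I_s -> {fset 'rV[int]_n})
  (b : 'I_s -> 'rV[int]_n -> R) (i : 'I_s) (xi : 'rV[R]_n) : nat :=
  count (fun a => all (fun a' => pairing xi a' - b i a' <= pairing xi a - b i a)
                      (enum_fset (A i)))
        (enum_fset (A i)).

Definition mult (n s : nat) (A : 'I_s -> {fset 'rV[int]_n})
  (b : 'I_s -> 'rV[int]_n -> R) (i : 'I_s) (xi : 'rV[R]_n) : int :=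
  (nmax A b i xi)%:Z - 1.

(* affine flag F_d = p + span(v_1,...,v_d), v_k = k-th row of V *)
Definition flag (n : nat) (p : 'rV[R]_n) (V : 'M[R]_n) (d : nat) : set 'rV[R]_n :=
  [set xi | exists c : 'rV[R]_n,
      (forall k : 'I_n, (d <= k)%N -> c 0 k = 0) /\ xi = p + c *m V].

Definition Xset (n s : nat) (A : 'I_s -> {fset 'rV[int]_n})
  (b : 'I_s -> 'rV[int]_n -> R) (p : 'rV[R]_n) (V : 'M[R]_n)
  (md : 'I_s -> nat -> nat) (d : nat) : set 'rV[R]_n :=
  [set xi | flag p V d xi /\ forall i, (md i d)%:Z <= mult A b i xi].

Definition Xset' (n s : nat) (A : 'I_s -> {fset 'rV[int]_n})
  (b : 'I_s -> 'rV[int]_n -> R) (p : 'rV[R]_n) (V : 'M[R]_n)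
  (md : 'I_s -> nat -> nat) (d : nat) : set 'rV[R]_n :=
  [set xi | flag p V d xi /\ forall i, (md i d.-1)%:Z <= mult A b i xi].

(* line segments and half-lines: (true, x, y) is the segment [x,y]
   (x != y), (false, x, v) is the half-line x + R_{>=0} v (v != 0) *)
Definition piece_ok (n : nat) (q : bool * 'rV[R]_n * 'rV[R]_n) : Prop :=
  if q.1.1 then q.1.2 != q.2 else q.2 != 0.

Definition piece_set (n : nat) (q : bool * 'rV[R]_n * 'rV[R]_n) : set 'rV[R]_n :=
  if q.1.1 then [set z | exists2 t : R, 0 <= t <= 1 & z = q.1.2 + t *: (q.2 - q.1.2)]
  else [set z | exists2 t : R, 0 <= t & z = q.1.2 + t *: q.2].

Definition piece_interior (n : nat) (q : bool * 'rV[R]_n * 'rV[R]_n) : set 'rV[R]_n :=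
  if q.1.1 then [set z | exists2 t : R, 0 < t < 1 & z = q.1.2 + t *: (q.2 - q.1.2)]
  else [set z | exists2 t : R, 0 < t & z = q.1.2 + t *: q.2].

Definition finite_union_segs_halflines (n : nat) (X : set 'rV[R]_n) : Prop :=
  exists L : seq (bool * 'rV[R]_n * 'rV[R]_n),
    (forall q, q \in L -> piece_ok q) /\
    X = [set z | exists2 q, q \in L & piece_set q z].

End Defs.

(* Main.v *)
(* Write the vectors (-e_i, a) attached to the points attaining the maxima at xi
   as affine forms in (lambda, xi).  General position makes the forms tied at xi
   linearly independent, and for a generic flag they stay as independent as
   possible on each F_d.  On X'_d this leaves two kinds of points: if s+d-1 forms
   are tied, X'_d is locally a line transversal to F_{d-1}; if s+d are tied, the
   edges at xi are obtained by releasing one of the ties of the index i that has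
   one too many.  In the dual basis of the tied forms the edge directions sum to
   the direction where lambda_i alone varies, i.e. to xi = 0.  Hence the function l
   on F_d vanishing on F_{d-1} strictly decreases along some edge and strictly
   increases along another.  A component of X'_d avoiding F_{d-1} would have l of
   constant sign, and |l| would attain its minimum at an endpoint of one of its
   finitely many segments and half-lines: contradiction. *)
Require Import Defs.
From HB Require Import structures.
From mathcomp Require Import all_boot all_order all_algebra finmap.
From mathcomp Require Import all_classical all_reals all_analysis.
From mathcomp Require Import lra zify.
Set Implicit Arguments. Unset Strict Implicit. Unset Printing Implicit Defensive.
Import Order.TTheory GRing.Theory Num.Theory.
Import numFieldNormedType.Exports.
Local Open Scope classical_set_scope.
Local Open Scope ring_scope.

(** * Generic sets and nonvanishing of regular functions *)
(** Openness is what lets density survive finite intersections. *)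
Definition generic {T : topologicalType} (U : set T) : Prop := open U /\ dense U.

Lemma generic_setT {T : topologicalType} : generic [set: T].
Proof. by split; [exact: openT|move=> O ? ?; rewrite setIT]. Qed.

Lemma genericI {T : topologicalType} (U V : set T) :
  generic U -> generic V -> generic (U `&` V).
Proof.
move=> [oU dU] [oV dV]; split; first exact: openI.
move=> O O0 oO; rewrite setIA; apply: dV; first exact: dU.
exact: openI.
Qed.

Lemma generic_finite {T : topologicalType} {I : finType} (U : I -> set T) :
  (forall i, generic (U i)) ->
  exists2 V : set T, generic V & forall x, V x -> forall i, U i x.
Proof.
move=> gU.
have [V gV UV] : exists2 V : set T, generic V &
    forall x, V x -> forall i, i \in enum I -> U i x.
  elim: (enum I) => [|i e [V gV UV]]; first by exists setT => //; exact: generic_setT.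
  exists (U i `&` V); first exact: genericI.
  by move=> x [Ux /UV Vx] j; rewrite inE => /orP[/eqP->//|/Vx].
by exists V => // x /UV Vx i; apply: Vx; rewrite mem_enum.
Qed.

Section RegularFunctions.
Variables (R : realType) (E : normedModType R).

(** Polynomial behaviour is recorded through restrictions to lines, so that no coordinates on the
    space of pairs [(p, V)] are needed. *)
Definition regular (f : E -> R) : Prop :=
  continuous f /\
  forall x y : E, exists P : {poly R}, forall t, f (x + t *: y) = P.[t].

Lemma regular_cst a : regular (fun=> a).
Proof.
split; first by move=> x; exact: cvg_cst.
by move=> x y; exists a%:P => t; rewrite hornerC.
Qed.

Lemma regularD f g : regular f -> regular g -> regular (fun x => f x + g x).
Proof.
move=> [cf rf] [cg rg]; split; first by move=> x; apply: cvgD; [exact: cf|exact: cg].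
move=> x y; have [P fP] := rf x y; have [Q gQ] := rg x y.
by exists (P + Q) => t; rewrite fP gQ hornerD.
Qed.

Lemma regularM f g : regular f -> regular g -> regular (fun x => f x * g x).
Proof.
move=> [cf rf] [cg rg]; split; first by move=> x; apply: cvgM; [exact: cf|exact: cg].
move=> x y; have [P fP] := rf x y; have [Q gQ] := rg x y.
by exists (P * Q) => t; rewrite fP gQ hornerM.
Qed.

Lemma regular_sum (I : Type) (r : seq I) (P : pred I) (F : I -> E -> R) :
  (forall i, regular (F i)) -> regular (fun x => \sum_(i <- r | P i) F i x).
Proof.
move=> rF; elim: r => [|i r IH].
  under eq_fun do rewrite big_nil.
  exact: regular_cst.
under eq_fun do rewrite big_cons.
by case: (P i) => //; exact: regularD.
Qed.

Lemma regular_prod (I : Type) (r : seq I) (P : pred I) (F : I -> E -> R) :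
  (forall i, regular (F i)) -> regular (fun x => \prod_(i <- r | P i) F i x).
Proof.
move=> rF; elim: r => [|i r IH].
  under eq_fun do rewrite big_nil.
  exact: regular_cst.
under eq_fun do rewrite big_cons.
by case: (P i) => //; exact: regularM.
Qed.

Lemma regular_det k (M : E -> 'M[R]_k) :
  (forall i j, regular (fun x => M x i j)) -> regular (fun x => \det (M x)).
Proof.
move=> rM; rewrite /determinant; apply: regular_sum => sg.
apply: regularM; first exact: regular_cst.
by apply: regular_prod => i; exact: rM.
Qed.

Lemma linear_regular (f : E -> R) :
  continuous f -> (forall x y t, f (x + t *: y) = f x + t * f y) -> regular f.
Proof.
move=> cf lf; split => // x y; exists ((f x)%:P + (f y) *: 'X) => t.
by rewrite lf hornerD hornerC hornerZ hornerX mulrC.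
Qed.

(** On the line joining any [x] to [x0] the function is a nonzero polynomial, with finitely many
    roots, so it has nonroots arbitrarily close to [x]. *)
Lemma regular_neq0_generic (f : E -> R) (x0 : E) :
  regular f -> f x0 != 0 -> generic [set x | f x != 0].
Proof.
move=> [cf rf] f0; split.
  rewrite (_ : [set _ | _] = f @^-1` [set y | y != 0]) //.
  by apply: open_comp => [x _|]; [exact: cf|exact: open_neq].
move=> O [x Ox] oO.
have [P fP] := rf x (x0 - x).
have P0 : P != 0.
  apply: contraNneq f0 => P0.
  by have := fP 1; rewrite scale1r subrKC P0 horner0 => ->.
have cline : (fun t : R => x + t *: (x0 - x)) @ (0 : R) --> x + 0 *: (x0 - x).
  apply: cvgD; first exact: cvg_cst.
  by apply: cvgZr_tmp; exact: cvg_id.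
have : \forall t \near (0 : R), O (x + t *: (x0 - x)).
  by apply: cline; rewrite scale0r addr0; apply: open_nbhs_nbhs.
move=> /nbhs_ballP[e /= e0 eO].
(* These [size P] distinct parameters lie strictly between 0 and [e], and a nonzero [P] has fewer
   than [size P] roots. *)
pose ts := [seq e / k.+2%:R | k <- iota 0 (size P)].
have uts : uniq ts.
  rewrite map_inj_uniq ?iota_uniq// => j k /(mulfI (lt0r_neq0 e0)) /invr_inj/eqP.
  by rewrite eqr_nat => /eqP [].
have : ~~ all (root P) ts.
  apply/negP => /(max_poly_roots P0)/(_ uts).
  by rewrite size_map size_iota ltnn.
move=> /allPn[t /mapP[k _ ->]] nroot.
exists (x + (e / k.+2%:R) *: (x0 - x)); split.
  apply: eO; rewrite /ball/= sub0r normrN ger0_norm ?divr_ge0 ?ltW//.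
  by rewrite ltr_pdivrMr// ltr_pMr// ltr1n.
by rewrite /= fP.
Qed.

End RegularFunctions.

(** * Linear systems with generic coefficients *)
Section LinearSystems.
Variable R : realType.

Definition dot {n : nat} (u v : 'rV[R]_n) : R := \sum_k u 0 k * v 0 k.

Lemma dotDl n (u u' v : 'rV[R]_n) : dot (u + u') v = dot u v + dot u' v.
Proof. by rewrite -big_split; apply: eq_bigr => k _; rewrite mxE mulrDl. Qed.

Lemma dotZl n t (u v : 'rV[R]_n) : dot (t *: u) v = t * dot u v.
Proof. by rewrite mulr_sumr; apply: eq_bigr => k _; rewrite mxE mulrA. Qed.

Lemma dot0l n (v : 'rV[R]_n) : dot 0 v = 0.
Proof. by rewrite -(scale0r 0) dotZl mul0r. Qed.

Lemma dotNl n (u v : 'rV[R]_n) : dot (- u) v = - dot u v.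
Proof. by rewrite -scaleN1r dotZl mulN1r. Qed.

Lemma dotBl n (u u' v : 'rV[R]_n) : dot (u - u') v = dot u v - dot u' v.
Proof. by rewrite dotDl dotNl. Qed.

Lemma dot_suml n (I : Type) (r : seq I) (P : pred I) (F : I -> 'rV[R]_n) v :
  dot (\sum_(i <- r | P i) F i) v = \sum_(i <- r | P i) dot (F i) v.
Proof.
by apply: (big_morph (fun u => dot u v)) => [u u'|]; [exact: dotDl|exact: dot0l].
Qed.

Lemma dot_row_mx m n (u u' : 'rV[R]_m) (v v' : 'rV[R]_n) :
  dot (row_mx u v) (row_mx u' v') = dot u u' + dot v v'.
Proof.
rewrite /dot big_split_ord; congr (_ + _); apply: eq_bigr => k _.
  by rewrite !row_mxEl.
by rewrite !row_mxEr.
Qed.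

Lemma dot_delta n (u : 'rV[R]_n) k : dot u (delta_mx 0 k) = u 0 k.
Proof.
rewrite /dot (bigD1 k)//= mxE !eqxx mulr1 big1 ?addr0// => j /negbTE jk.
by rewrite mxE jk andbF mulr0.
Qed.

Lemma dotNr n (u v : 'rV[R]_n) : dot u (- v) = - dot u v.
Proof. by rewrite -sumrN; apply: eq_bigr => k _; rewrite mxE mulrN. Qed.

Lemma dot0r n (u : 'rV[R]_n) : dot u 0 = 0.
Proof. by rewrite /dot big1// => k _; rewrite mxE mulr0. Qed.

Lemma mulmx_tr_dot n (u v : 'rV[R]_n) : u *m v^T = (dot u v)%:M.
Proof.
apply/matrixP => i j; rewrite !ord1 !mxE eqxx mulr1n.
by apply: eq_bigr => k _; rewrite mxE.
Qed.

Variables (N : nat) (I : finType) (P : {set I}) (r : I -> 'rV[R]_N).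

Definition jointly_injective : Prop :=
  forall x : 'rV[R]_N, (forall i, i \in P -> dot x (r i) = 0) -> x = 0.

(** The quadratic form of the Gram matrix is the sum of the squares of [dot v (r i)], so both have
    the same kernel. The determinant expresses injectivity by one polynomial inequation, even with
    more forms than unknowns. *)
Lemma gram_det_neq0 :
  \det (\sum_(i in P) (r i)^T *m r i) != 0 <-> jointly_injective.
Proof.
split=> [dG x xr|inj].
  have uG : (\sum_(i in P) (r i)^T *m r i) \in unitmx by rewrite unitmxE unitfE.
  rewrite -[x](mulmxK uG) mulmx_sumr big1 ?mul0mx// => i iP.
  by rewrite mulmxA mulmx_tr_dot xr// raddf0 mul0mx.
apply/negP => /det0P[v v0 vG]; move: v0; apply/negP; rewrite negbK; apply/eqP.
have : \sum_(i in P) (dot v (r i)) ^+ 2 = 0.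
  transitivity ((v *m (\sum_(i in P) (r i)^T *m r i) *m v^T) 0 0); last first.
    by rewrite vG mul0mx mxE.
  rewrite mulmx_sumr mulmx_suml summxE.
  apply: eq_bigr => i _; rewrite mulmxA (mulmx_tr_dot v (r i)) mul_scalar_mx -scalemxAl.
  rewrite mulmx_tr_dot !mxE eqxx mulr1n expr2; congr (_ * _).
  by apply: eq_bigr => k _; rewrite mulrC.
move/psumr_eq0P => sq0; apply: inj => i iP.
by apply/eqP; rewrite -sqrf_eq0; apply/eqP/sq0 => // j _; exact: sqr_ge0.
Qed.

(** With as many forms as unknowns the matrix of the family is square, so full row rank is full
    column rank. *)
Lemma jointly_surjective : jointly_injective -> #|P| = N ->
  forall y : I -> R, exists x : 'rV[R]_N, forall i, i \in P -> dot x (r i) = y i.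
Proof.
move=> inj PN y.
pose M : 'M[R]_(N, #|P|) := \matrix_(j, k) r (enum_val k) 0 j.
have ME x k : (x *m M) 0 k = dot x (r (enum_val k)).
  by rewrite mxE; apply: eq_bigr => j _; rewrite mxE.
have fM : row_free M.
  apply: inj_row_free => x xM; apply: inj => i iP.
  by rewrite -(enum_rankK_in iP iP) -ME xM mxE.
have /row_fullP[B BM] : row_full M by move/eqP: fM => fM; apply/eqP; rewrite fM.
exists ((\row_k y (enum_val k)) *m B) => i iP.
rewrite -{1}(enum_rankK_in iP iP) -ME -mulmxA BM mulmx1 mxE.
by rewrite enum_rankK_in.
Qed.

End LinearSystems.

(** * Tied points as affine forms in the unknowns (mu, c), and their nondegeneracy *)

Section Forms.
Variables (R : realType) (n s : nat) (Q : finType).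
Variables (idx : Q -> 'I_s) (pt : Q -> 'rV[R]_n) (h : Q -> R).

(* Linear independence of the vectors (-e_i, a) indexed by [T], stated as
   surjectivity of the family of forms they define. *)
Definition indep (T : {set Q}) : Prop :=
  forall y : Q -> R, exists (mu : 'I_s -> R) (u : 'rV[R]_n),
    forall q, q \in T -> dot u (pt q) - mu (idx q) = y q.

Definition coverI (T : {set Q}) : Prop := forall i, exists q, q \in T /\ idx q = i.

Lemma indepS (T T' : {set Q}) : T' \subset T -> indep T -> indep T'.
Proof.
move=> /fintype.subsetP TT' iT y; have [mu [u muu]] := iT y.
by exists mu, u => q /TT'; exact: muu.
Qed.

(* [c 0 0] is a homogenizing coordinate: with [W = col_mx p V] and [c 0 0 = 1],
   [c *m W] is a point of the flag, and with [c 0 0 = 0] a direction. *)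
Definition form (W : 'M[R]_(n.+1, n)) (mu : 'rV[R]_s) (c : 'rV[R]_n.+1) (q : Q) : R :=
  dot (c *m W) (pt q) - c 0 0 * h q - mu 0 (idx q).

Definition form_coef (W : 'M[R]_(n.+1, n)) (q : Q) (k : 'I_n.+1) : R :=
  dot (row k W) (pt q) - (k == 0)%:R * h q.

Lemma formE W mu c q :
  form W mu c q = \sum_k c 0 k * form_coef W q k - mu 0 (idx q).
Proof.
rewrite /form mulmx_sum_row dot_suml; congr (_ - _).
rewrite /form_coef; under [RHS]eq_bigr do rewrite mulrBr.
rewrite sumrB; congr (_ - _).
  by apply: eq_bigr => k _; rewrite dotZl.
by rewrite (bigD1 0)//= mulr1n mul1r big1 ?addr0// => k /negbTE ->; rewrite mul0r mulr0.
Qed.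

(** [D] lists the coordinates of [c] forced to vanish: a tail of coordinates cuts down to a member
    F_d of the flag, and putting 0 in [D] restricts to directions. *)
Definition nondegenerate (W : 'M[R]_(n.+1, n)) (T : {set Q}) (D : {set 'I_n.+1}) :=
  forall (mu : 'rV[R]_s) (c : 'rV[R]_n.+1), (forall k, k \in D -> c 0 k = 0) ->
    (forall q, q \in T -> form W mu c q = 0) -> mu = 0 /\ c = 0.

(** The forms of [T] and the coordinates in [D] are put in one family so that a single Gram
    determinant handles both. *)
Definition system (W : 'M[R]_(n.+1, n)) (i : Q + 'I_n.+1) : 'rV[R]_(s + n.+1) :=
  match i with
  | inl q => row_mx (- delta_mx 0 (idx q)) (\row_k form_coef W q k)
  | inr k => row_mx 0 (delta_mx 0 k)
  end.

Definition system_dom (T : {set Q}) (D : {set 'I_n.+1}) : {set Q + 'I_n.+1} :=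
  [set i | match i with inl q => q \in T | inr k => k \in D end]%SET.

Lemma card_system_dom T D : #|system_dom T D| = (#|T| + #|D|)%N.
Proof.
have -> : system_dom T D = inl @: T :|: inr @: D.
  apply/setP => -[q|k]; rewrite !inE.
    rewrite mem_imset; last by move=> ? ? [].
    by case: (q \in T) => //=; apply/esym/negbTE/imsetP => -[].
  rewrite orbC mem_imset; last by move=> ? ? [].
  by case: (k \in D) => //=; apply/esym/negbTE/imsetP => -[].
rewrite cardsU (_ : _ :&: _ = finset.set0) ?cards0 ?subn0.
  by rewrite !card_imset// => ? ? [].
by apply/setP => i; rewrite !inE; apply/negbTE/andP => -[/imsetP[q _ ->] /imsetP[]].
Qed.

Lemma dot_system_inl W mu c q : dot (row_mx mu c) (system W (inl q)) = form W mu c q.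
Proof.
rewrite dot_row_mx dotNr dot_delta formE addrC; congr (_ - _).
by apply: eq_bigr => k _; rewrite mxE.
Qed.

Lemma dot_system_inr W mu c k : dot (row_mx mu c) (system W (inr k)) = c 0 k.
Proof. by rewrite dot_row_mx dot0r add0r dot_delta. Qed.

Lemma nondegenerateP W T D :
  nondegenerate W T D <-> jointly_injective (system_dom T D) (system W).
Proof.
split=> [nd x x0|ji mu c cD cT].
  rewrite -[x]hsubmxK in x0 *.
  have [] := nd (lsubmx x) (rsubmx x).
  - by move=> k kD; rewrite -(dot_system_inr W (lsubmx x)); apply: x0; rewrite inE.
  - by move=> q qT; rewrite -dot_system_inl; apply: x0; rewrite inE.
  - by move=> -> ->; rewrite row_mx0.
have : row_mx mu c = 0.
  apply: ji => -[q|k]; rewrite inE => iP; first by rewrite dot_system_inl cT.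
  by rewrite dot_system_inr cD.
by rewrite -row_mx0 => /eq_row_mx.
Qed.

Lemma nondegenerate_surj W T D : nondegenerate W T D -> (#|T| + #|D|)%N = (s + n.+1)%N ->
  forall y : Q -> R, exists (mu : 'rV[R]_s) (c : 'rV[R]_n.+1), (forall k, k \in D -> c 0 k = 0) /\
    (forall q, q \in T -> form W mu c q = y q).
Proof.
move=> /nondegenerateP ji cTD y.
have [x xP] := jointly_surjective ji (etrans (card_system_dom T D) cTD)
   (fun i => if i is inl q then y q else 0).
rewrite -[x]hsubmxK in xP.
exists (lsubmx x), (rsubmx x); split=> [k kD|q qT].
  by rewrite -(dot_system_inr W (lsubmx x)) xP// inE.
by rewrite -dot_system_inl xP// inE.
Qed.

(* After spending one element of [T] per index [i] to control [mu], the rows of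
   [W] outside [D] are taken dual to distinct remaining elements of [T]. *)
Lemma nondegenerate_exists T D : indep T -> coverI T -> (#|~: D| + s <= #|T|)%N ->
  exists W, nondegenerate W T D.
Proof.
move=> iT /boolp.choice[q0 /all_and2[q0T q0i]] cT.
pose T1 := T :\: [set q0 i | i : 'I_s]%SET.
have cT1 : (#|~: D| <= #|T1|)%N.
  have := cardsID [set q0 i | i : 'I_s]%SET T; rewrite -/T1 => cardT.
  rewrite -(leq_add2r s) (leq_trans cT)// -cardT addnC leq_add2l.
  apply: (leq_trans (subset_leq_card (subsetIr _ _))).
  by apply: (leq_trans (leq_imset_card _ _)); rewrite card_ord.
(* Coordinates outside [D] are matched with elements of [T1] by their positions in the two
   enumerations. *)
pose same (k : 'I_n.+1) (q : Q) := index q (enum T1) == index k (enum (~: D)).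
(* Row [u0 k] is chosen so that, up to the multipliers [mu0 k], its coefficient at [q] is
   [same k q]; the term in [h q] offsets the one in [form_coef]. *)
have /boolp.choice[mu0 /boolp.choice[u0 mu0P]] : forall k : 'I_n.+1,
    exists (mu : 'I_s -> R) (u : 'rV[R]_n), forall q, q \in T ->
      dot u (pt q) - mu (idx q) = (same k q)%:R + (k == 0)%:R * h q.
  by move=> k; exact: iT.
exists (\matrix_k u0 k) => mu c cD form0.
pose mu' i := \sum_k c 0 k * mu0 k i - mu 0 i.
have eq0 q : q \in T -> mu' (idx q) + \sum_k c 0 k * (same k q)%:R = 0.
  move=> qT; rewrite -[RHS](form0 q qT) formE /mu' addrAC; congr (_ - _).
  rewrite -big_split; apply: eq_bigr => k _ /=; rewrite -mulrDr; congr (_ * _).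
  rewrite /form_coef rowK; have /eqP := mu0P k q qT.
  rewrite subr_eq => /eqP ->; lra.
have ltD k : k \notin D -> (index k (enum (~: D)) < #|~: D|)%N.
  by move=> kD; rewrite [#|_|]cardE index_mem mem_enum inE.
(* [q0 i] lies outside [T1], so no coordinate outside [D] is matched with it and its equation
   reduces to [mu' i = 0]. *)
have mu'0 i : mu' i = 0.
  rewrite -[RHS](eq0 _ (q0T i)) q0i big1 ?addr0// => k _.
  have [kD|kD] := boolP (k \in D); first by rewrite cD ?mul0r.
  rewrite /same (memNindex (x := q0 i)); last first.
    by rewrite mem_enum !inE negb_and negbK imset_f.
  by rewrite -cardE gtn_eqF ?mulr0// (leq_trans (ltD _ kD)).
(* With [mu'] gone, the equation of the element matched with [k] reads [c 0 k = 0]. *)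
have c0 : c = 0.
  apply/matrixP => i k; rewrite ord1 mxE {i}.
  have [kD|kD] := boolP (k \in D); first by rewrite cD.
  have [q qT1 sq] : exists2 q, q \in T1 & same k q.
    have := leq_trans (ltD _ kD) cT1; rewrite [#|T1|]cardE => klt.
    case e : (enum T1) klt => [//|q1 l] klt; rewrite -e in klt.
    exists (nth q1 (enum T1) (index k (enum (~: D)))).
      by rewrite -mem_enum mem_nth.
    by rewrite /same index_uniq// enum_uniq.
  have := eq0 q; rewrite mu'0 add0r (bigD1 k)//= sq mulr1 big1 ?addr0.
    by apply; move: qT1; rewrite inE => /andP[].
  move=> j jk; have [jD|jD] := boolP (j \in D); first by rewrite cD ?mul0r.
  rewrite /same; case: eqP; rewrite ?mulr0// (eqP sq) => /index_inj ekj.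
  by rewrite ekj ?eqxx// ?mem_enum ?inE in jk.
split=> //; apply/matrixP => i j; rewrite ord1 mxE {i}.
have := mu'0 j; rewrite /mu' big1 ?sub0r => [|k _]; last by rewrite c0 mxE mul0r.
by move/eqP; rewrite oppr_eq0 => /eqP.
Qed.

(** The Gram determinant is polynomial in the entries of [p] and [V] and is nonzero at the matrix
    built in [nondegenerate_exists]. *)
Lemma nondegenerate_generic T D : indep T -> coverI T -> (#|~: D| + s <= #|T|)%N ->
  generic [set pV : 'rV[R]_n * 'M[R]_n | nondegenerate (col_mx pV.1 pV.2) T D].
Proof.
move=> iT cT cardT; have [W ndW] := nondegenerate_exists iT cT cardT.
pose f (pV : 'rV[R]_n * 'M[R]_n) := \det (\sum_(i in system_dom T D)
  (system (col_mx pV.1 pV.2) i)^T *m system (col_mx pV.1 pV.2) i).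
rewrite (_ : [set _ | _] = [set pV | f pV != 0]); last first.
  apply/seteqP; split=> pV /=.
    by move=> nd; apply/gram_det_neq0/nondegenerateP.
  by move=> /gram_det_neq0/nondegenerateP.
apply: (@regular_neq0_generic _ _ _ (usubmx (W : 'M[R]_(1 + n, n)), dsubmx (W : 'M[R]_(1 + n, n)))).
  have rcol (k : 'I_(1 + n)) j :
      regular (fun pV : 'rV[R]_n * 'M[R]_n => col_mx pV.1 pV.2 k j).
    case: (fintype.split_ordP k) => i -> {k}.
      under eq_fun do rewrite col_mxEu.
      apply: linear_regular => [x|x y t]; last by rewrite !mxE.
      by apply: (@continuous_comp _ _ _ fst (fun M : 'rV[R]_n => M i j));
        [exact: cvg_fst|exact: coord_continuous].
    under eq_fun do rewrite col_mxEd.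
    apply: linear_regular => [x|x y t]; last by rewrite !mxE.
    by apply: (@continuous_comp _ _ _ snd (fun M : 'M[R]_n => M i j));
      [exact: cvg_snd|exact: coord_continuous].
  have rsys i a : regular (fun pV : 'rV[R]_n * 'M[R]_n =>
      system (col_mx pV.1 pV.2) i 0 a).
    case: i => [q|k] /=; last exact: regular_cst.
    case: (fintype.split_ordP a) => k -> {a}.
      by under eq_fun do rewrite row_mxEl; exact: regular_cst.
    under eq_fun do rewrite row_mxEr mxE.
    apply: regularD; last exact: regular_cst.
    apply: regular_sum => j; apply: regularM; last exact: regular_cst.
    by under eq_fun do rewrite mxE; exact: rcol.
  apply: regular_det => a b; under eq_fun do rewrite summxE.
  apply: regular_sum => i; under eq_fun do rewrite mxE.
  apply: regular_sum => j; rewrite (ord1 j); apply: regularM; last exact: rsys.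
  by under eq_fun do rewrite mxE; exact: rsys.
rewrite /f /= (vsubmxK (W : 'M[R]_(1 + n, n))).
by apply/gram_det_neq0/nondegenerateP.
Qed.

End Forms.

(** * Finite unions of segments and half-lines *)
Section Pieces.
Variable R : realType.

Lemma itv_max_or_unbounded (I : set R) : closed I -> is_interval I -> I !=set0 ->
  (exists2 M, I M & forall t, I t -> t <= M) \/ (forall a t, I a -> a <= t -> I t).
Proof.
move=> cI iI I0; have [ubI|nubI] := pselect (has_ubound I); [left|right].
  exists (sup I); last by move=> t It; apply: ub_le_sup.
  by apply: cI; exact: closure_sup.
move=> a t Ia at_; have [b Ib tb] : exists2 b, I b & t < b.
  apply: contrapT => nb; apply: nubI; exists t => b Ib.
  by rewrite leNgt; apply/negP => tb; apply: nb; exists b.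
by apply: (iI a b Ia Ib); rewrite at_ ltW.
Qed.

Lemma itv_min_or_unbounded (I : set R) : closed I -> is_interval I -> I !=set0 ->
  (exists2 M, I M & forall t, I t -> M <= t) \/ (forall a t, I a -> t <= a -> I t).
Proof.
move=> cI iI [a0 Ia0]; have [] := @itv_max_or_unbounded (-%R @^-1` I).
- by apply: closed_comp => // t _; exact: opp_continuous.
- move=> x y Ix Iy z /andP[xz zy]; apply: (iI _ _ Iy Ix).
  by rewrite !lerN2 xz zy.
- by exists (- a0); rewrite /= opprK.
- move=> [M IM leM]; left; exists (- M) => // t It.
  by rewrite lerNl; apply: leM; rewrite /= opprK.
- move=> ubI; right => a t Ia ta; rewrite -[t]opprK.
  by apply: (ubI (- a)); rewrite /= ?opprK ?lerN2.
Qed.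

Variable n : nat.
Implicit Types (x u : 'rV[R]_n) (X : set 'rV[R]_n) (q : bool * 'rV[R]_n * 'rV[R]_n).

(** A closed interval is bounded or not on each side: this gives a segment, a half-line in either
    direction, or a full line cut into two opposite half-lines. The two points [a < b] keep the
    segment from collapsing. *)
Lemma itv_finite_union (I : set R) x u a b :
  closed I -> is_interval I -> I a -> I b -> a < b -> u != 0 ->
  finite_union_segs_halflines [set x + t *: u | t in I].
Proof.
move=> cI iI Ia Ib ab u0; have I0 : I !=set0 by exists a.
have [[m Im lem]|lb] := itv_min_or_unbounded cI iI I0;
have [[M IM leM]|ub] := itv_max_or_unbounded cI iI I0.
- have mM : m < M by apply: (le_lt_trans (lem _ Ia)); apply: (lt_le_trans ab); exact: leM.
  have mM0 : M - m != 0 by rewrite subr_eq0 gt_eqF.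
  exists [:: (true, x + m *: u, x + M *: u)]; split=> [q|].
    rewrite inE => /eqP ->; rewrite /piece_ok /= -subr_eq0.
    by rewrite opprD addrACA subrr add0r -scalerBl scaler_eq0 negb_or u0 subr_eq0 lt_eqF.
  have E t : x + m *: u + t *: (x + M *: u - (x + m *: u)) = x + (m + t * (M - m)) *: u.
    by rewrite opprD addrACA subrr add0r -scalerBl scalerA scalerDl addrA.
  apply/seteqP; split=> z /=.
    move=> [t It <-]; exists (true, x + m *: u, x + M *: u); first by rewrite inE.
    exists ((t - m) / (M - m)); last by rewrite /= E divfK// subrKC.
    rewrite divr_ge0 ?subr_ge0 ?lem ?(ltW mM)//= ler_pdivrMr ?subr_gt0//.
    by rewrite mul1r lerD2r leM.
  move=> [q]; rewrite inE => /eqP -> [t /andP[t0 t1] ->]; rewrite /= E.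
  exists (m + t * (M - m)) => //; apply: (iI _ _ Im IM).
  by apply/andP; split; nra.
- exists [:: (false, x + m *: u, u)]; split=> [q|].
    by rewrite inE => /eqP ->.
  apply/seteqP; split=> z /=.
    move=> [t It <-]; exists (false, x + m *: u, u); first by rewrite inE.
    exists (t - m); first by rewrite subr_ge0 lem.
    by rewrite /= -addrA -scalerDl subrKC.
  move=> [q]; rewrite inE => /eqP -> [t t0 ->] /=.
  exists (m + t); last by rewrite scalerDl addrA.
  by apply: (ub _ _ Im); rewrite lerDl.
- exists [:: (false, x + M *: u, - u)]; split=> [q|].
    by rewrite inE => /eqP ->; rewrite /piece_ok /= oppr_eq0.
  apply/seteqP; split=> z /=.
    move=> [t It <-]; exists (false, x + M *: u, - u); first by rewrite inE.
    exists (M - t); first by rewrite subr_ge0 leM.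
    by rewrite /= -addrA scalerN -scalerBl subKr.
  move=> [q]; rewrite inE => /eqP -> [t t0 ->] /=.
  exists (M - t); last by rewrite scalerBl addrA scalerN.
  by apply: (lb _ _ IM); rewrite gerBl.
- exists [:: (false, x, u); (false, x, - u)]; split=> [q|].
    by rewrite !inE => /orP[] /eqP ->; rewrite /piece_ok /= ?oppr_eq0.
  have IT t : I t by case: (leP a t) => [/(ub _ _ Ia)|/ltW/(lb _ _ Ia)].
  apply/seteqP; split=> z /=.
    move=> [t It <-]; case: (leP 0 t) => t0.
      by exists (false, x, u); [rewrite inE eqxx|exists t].
    exists (false, x, - u); first by rewrite !inE eqxx orbT.
    by exists (- t); rewrite ?oppr_ge0 ?ltW//= scalerN scaleNr opprK.
  move=> [q]; rewrite !inE => /orP[] /eqP -> [t t0 ->] /=; first by exists t.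
  by exists (- t) => //; rewrite scalerN scaleNr.
Qed.

Lemma finite_union0 : finite_union_segs_halflines (set0 : set 'rV[R]_n).
Proof. by exists [::]; split=> //; apply/seteqP; split=> // z [q]. Qed.

Lemma finite_unionU X Y : finite_union_segs_halflines X ->
  finite_union_segs_halflines Y -> finite_union_segs_halflines (X `|` Y).
Proof.
move=> [L [okL ->]] [L' [okL' ->]]; exists (L ++ L'); split=> [q|].
  by rewrite mem_cat => /orP[/okL|/okL'].
apply/seteqP; split=> z /=.
  by move=> [] [q qL qz]; exists q => //; rewrite mem_cat qL ?orbT.
by move=> [q]; rewrite mem_cat => /orP[] qL qz; [left|right]; exists q.
Qed.

Lemma finite_union_bigcup (I : finType) (X : I -> set 'rV[R]_n) :
  (forall i, finite_union_segs_halflines (X i)) ->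
  finite_union_segs_halflines [set x | exists i, X i x].
Proof.
move=> fX; suff -> : [set x | exists i, X i x] = \big[setU/set0]_(i : I) X i.
  by apply: big_ind => //; [exact: finite_union0|exact: finite_unionU].
rewrite -bigcup_seq; apply/seteqP; split=> x.
  by move=> [i Xi]; exists i => //=; rewrite mem_index_enum.
by move=> [i _ Xi]; exists i.
Qed.

Lemma line_continuous x u : continuous (fun t : R => x + t *: u).
Proof.
move=> t; apply: cvgD; first exact: cvg_cst.
by apply: cvgZr_tmp; exact: cvg_id.
Qed.

Lemma line_connected (I : set R) x u : is_interval I ->
  connected [set z | exists2 t, I t & z = x + t *: u].
Proof.
move=> iI; rewrite (_ : [set _ | _] = (fun t : R => x + t *: u) @` I); last first.
  by apply/seteqP; split=> z [t It tz]; exists t.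
apply: connected_continuous_connected; first exact/connected_intervalP.
by apply: continuous_subspaceT; exact: line_continuous.
Qed.

Lemma piece_connected q : connected (piece_set q).
Proof.
case: q => [[[] x] y]; rewrite /piece_set/=; apply: line_connected.
  move=> a c /andP[a0 a1] /andP[c0 c1] z /andP[az zc].
  by rewrite (le_trans a0 az) (le_trans zc c1).
by move=> a c a0 c0 z /andP[az zc]; exact: le_trans a0 az.
Qed.

Lemma min_exists (T : eqType) (L : seq T) (f : T -> R) (t : T) : t \in L ->
  exists2 t0, t0 \in L & forall t', t' \in L -> f t0 <= f t'.
Proof.
elim: L t => [//|a L IH] t _; case: L IH => [|a' L] IH.
  by exists a; rewrite ?inE// => t'; rewrite inE => /eqP ->.
have [t0 t0L t0m] := IH a' (mem_head _ _).
have [at_|ta] := leP (f a) (f t0).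
  exists a; first exact: mem_head.
  move=> t'; rewrite inE => /orP[/eqP->//|/t0m]; exact: le_trans.
exists t0; first by rewrite inE t0L orbT.
by move=> t'; rewrite inE => /orP[/eqP->|/t0m//]; exact: ltW.
Qed.

Definition affine_with (l l0 : 'rV[R]_n -> R) : Prop :=
  forall x u t, l (x + t *: u) = l x + t * l0 u.

(** Otherwise [l] stays positive on the component, which is a union of whole pieces; [l] then has a
    minimum at the base of one of them, against the descent hypothesis. *)
Lemma component_zero_pos X l l0 xi :
  finite_union_segs_halflines X -> continuous l -> affine_with l l0 ->
  (forall x, X x -> exists u, l0 u < 0 /\
     exists2 e, 0 < e & forall t, 0 <= t <= e -> X (x + t *: u)) ->
  X xi -> 0 < l xi ->
  exists eta, connected_component X xi eta /\ l eta = 0.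
Proof.
move=> [L [okL XL]] cl al descent Xxi lxi.
set C := connected_component X xi.
have CX : C `<=` X by exact: connected_component_sub.
have Cxi : C xi by exact: connected_component_refl.
have subC B x : B x -> B `<=` X -> connected B -> C x -> B `<=` C.
  move=> Bx BX cB Cx; rewrite /C (same_connected_component Cx).
  exact: connected_component_max.
apply: contrapT => no_zero.
have lpos x : C x -> 0 < l x.
  move=> Cx; rewrite ltNge; apply/negP => lx0; apply: no_zero.
  have : connected (l @` C).
    apply: connected_continuous_connected; first exact: component_connected.
    by apply: continuous_subspaceT.
  move=> /connected_intervalP/(_ (l x) (l xi)) iC.
  have [] := iC _ _ 0; [by exists x|by exists xi|by rewrite lx0 ltW|].
  by move=> eta Ceta leta; exists eta.
pose inC q := `[< piece_set q `<=` C >].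
have pieceX q : q \in L -> piece_set q `<=` X by move=> qL z qz; rewrite XL; exists q.
have inCP z : C z -> exists q, [/\ q \in L, piece_set q z & inC q].
  move=> Cz; have := CX _ Cz; rewrite {1}XL => -[q qL qz]; exists q; split=> //.
  by apply/asboolP; apply: (subC _ z) => //; [exact: pieceX|exact: piece_connected].
(* The point of a piece where [l] is least: the lower end of a segment, the origin of a
   half-line. *)
pose base q := if q.1.1 && (l q.2 < l q.1.2) then q.2 else q.1.2.
have base_in q : piece_set q (base q).
  case: q => [[[] x] y]; rewrite /piece_set /base /=; last by exists 0; rewrite ?scale0r ?addr0.
  case: ifP => _; last by exists 0; rewrite ?lexx ?ler01// scale0r addr0.
  by exists 1; rewrite ?lexx ?ler01// scale1r subrKC.
have base_min q z : inC q -> piece_set q z -> l (base q) <= l z.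
  move=> /asboolP qC; case: q qC => [[[] x] y]; rewrite /piece_set /base /= => qC.
    move=> [t /andP[t0 t1] ->]; rewrite al.
    have -> : l0 (y - x) = l y - l x.
      by have := al x (y - x) 1; rewrite scale1r subrKC mul1r => ->; rewrite addrAC subrr add0r.
    by case: ltP => ?; nra.
  move=> [t t0 ->]; rewrite al lerDl mulr_ge0// leNgt; apply/negP => ly.
  (* Were [l] decreasing along the half-line, it would vanish at the parameter [- (l x / l0 y)]. *)
  have lx : 0 < l x by apply: lpos; apply: qC; exists 0; rewrite ?scale0r ?addr0.
  have : 0 < l (x + (- (l x / l0 y)) *: y).
    apply: lpos; apply: qC; exists (- (l x / l0 y)) => //.
    by rewrite oppr_ge0 mulr_ge0_le0 ?ltW// invr_lt0.
  by rewrite al mulNr divfK ?lt_eqF// subrr ltxx.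
have [q1 [q1L q1xi q1C]] := inCP _ Cxi.
have [|q0] := @min_exists _ [seq q <- L | inC q] (l \o base) q1.
  by rewrite mem_filter q1C.
rewrite mem_filter => /andP[q0C q0L] q0min.
have Cb : C (base q0) by move/asboolP : (q0C); apply.
have [u [lu [e e0 Xe]]] := descent _ (CX _ Cb).
have Ce : C (base q0 + e *: u).
  apply: (subC [set z | exists2 t, `[0, e]%classic t & z = base q0 + t *: u] (base q0)) => //.
  - by exists 0; rewrite ?scale0r ?addr0//= in_itv/= lexx ltW.
  - by move=> z [t]; rewrite /= in_itv/= => te ->; exact: Xe.
  - by apply: line_connected; exact: interval_is_interval.
  - by exists e => //=; rewrite in_itv/= lexx ltW.
have [q2 [q2L q2e q2C]] := inCP _ Ce.
have := le_trans (q0min q2 _) (base_min _ _ q2C q2e).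
rewrite mem_filter q2C => /(_ q2L); rewrite /= al; nra.
Qed.

Lemma component_zero X l l0 xi :
  finite_union_segs_halflines X -> continuous l -> affine_with l l0 ->
  (forall x, X x -> (exists u, l0 u < 0 /\
     exists2 e, 0 < e & forall t, 0 <= t <= e -> X (x + t *: u)) /\
     (exists u, 0 < l0 u /\
     exists2 e, 0 < e & forall t, 0 <= t <= e -> X (x + t *: u))) ->
  X xi -> exists eta, connected_component X xi eta /\ l eta = 0.
Proof.
move=> fX cl al loc Xxi; have [lxi|lxi|lxi] := ltgtP (l xi) 0.
- have [|||||eta [ceta leta]] :=
      @component_zero_pos X (fun x => - l x) (fun u => - l0 u) xi fX.
  + by move=> x; apply: (@continuous_comp _ _ _ l -%R); [exact: cl|exact: opp_continuous].
  + by move=> x u t; rewrite al opprD mulrN.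
  + move=> x /loc[_ [u [lu Xu]]]; exists u; split=> //.
    by rewrite oppr_lt0.
  + exact: Xxi.
  + by rewrite oppr_gt0.
  + by exists eta; split=> //; rewrite -[l eta]opprK leta oppr0.
- by apply: (component_zero_pos fX cl al) => // x /loc[].
- by exists xi; split=> //; exact: connected_component_refl.
Qed.

End Pieces.

(** * Ties and affine flags *)
Section Arrangement.
Variables (R : realType) (n s : nat) (Q : finType).
Variables (idx : Q -> 'I_s) (pt : Q -> 'rV[R]_n) (h : Q -> R).

Definition height (xi : 'rV[R]_n) (q : Q) : R := dot xi (pt q) - h q.

(** The points attaining lambda_i(xi), for all [i] together; thus [fib (tie xi) i] is m_i(xi) +
    1. *)
Definition tie (xi : 'rV[R]_n) : {set Q} :=
  [set q | [forall q', (idx q' == idx q) ==> (height xi q' <= height xi q)]]%SET.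

Definition fib (T : {set Q}) (i : 'I_s) : nat := #|[set q in T | idx q == i]%SET|.

Lemma tieP xi q :
  reflect (forall q', idx q' = idx q -> height xi q' <= height xi q) (q \in tie xi).
Proof.
rewrite inE; apply: (iffP forallP) => H q'.
  by move=> e; have := H q'; rewrite e eqxx.
by apply/implyP => /eqP; exact: H.
Qed.

Lemma height_tie xi q q' : q \in tie xi -> q' \in tie xi -> idx q = idx q' ->
  height xi q = height xi q'.
Proof. by move=> /tieP Hq /tieP Hq' e; apply/eqP; rewrite eq_le Hq ?Hq'. Qed.

Lemma height_line xi u t q : height (xi + t *: u) q = height xi q + t * dot u (pt q).
Proof. by rewrite /height dotDl dotZl addrAC. Qed.

Lemma sum_fib T : (\sum_i fib T i)%N = #|T|.
Proof.
rewrite -sum1_card (partition_big idx predT)//=; apply: eq_bigr => i _.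
by rewrite /fib -sum1_card; apply: eq_bigl => q; rewrite inE.
Qed.

Lemma fibS (T T' : {set Q}) i : T \subset T' -> (fib T i <= fib T' i)%N.
Proof.
move=> /fintype.subsetP TT'; apply: subset_leq_card; apply/fintype.subsetP => q.
by rewrite !inE => /andP[/TT' -> ->].
Qed.

Lemma fib_coverI T : (forall i, (0 < fib T i)%N) -> coverI idx T.
Proof.
by move=> H i; have /card_gt0P[q] := H i; rewrite inE => /andP[qT /eqP qi]; exists q.
Qed.

Lemma fib_setD1 (T : {set Q}) q i : q \in T -> fib T i = ((idx q == i) + fib (T :\ q) i)%N.
Proof.
move=> qT; rewrite /fib (cardsD1 q) !inE qT; congr (_ + _)%N.
by apply: eq_card => q'; rewrite !inE andbA.
Qed.

(** Finitely many strict inequalities survive a small displacement: [e] is the least of 1 and the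
    quotients [a q / (|c q| + 1)], whose denominators cannot vanish. *)
Lemma finite_slack (a c : Q -> R) (P : pred Q) : (forall q, P q -> 0 < a q) ->
  exists2 e, 0 < e & forall t q, 0 <= t <= e -> P q -> t * c q <= a q.
Proof.
move=> a0.
suff [e e0 eP] : exists2 e, 0 < e &
    forall t q, q \in enum Q -> 0 <= t <= e -> P q -> t * c q <= a q.
  by exists e => // t q; apply: eP; rewrite mem_enum.
elim: (enum Q) => [|q r [e e0 eP]]; first by exists 1.
have [Pq|nPq] := boolP (P q); last first.
  exists e => // t q'; rewrite inE => /orP[/eqP->|]; last exact: eP.
  by rewrite (negbTE nPq).
have ca0 : 0 < `|c q| + 1 by rewrite ltr_wpDl.
exists (Num.min e (a q / (`|c q| + 1))); first by rewrite lt_min e0 divr_gt0// a0.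
move=> t q'; rewrite inE le_min => /orP[/eqP->|q'r] /andP[t0 /andP[te ta]] Pq'.
  apply: (@le_trans _ _ (t * (`|c q| + 1))).
    by rewrite ler_wpM2l// (le_trans (ler_norm _))// lerDl.
  by rewrite -ler_pdivlMr.
by apply: eP => //; rewrite t0 te.
Qed.

(** Along [u] the points of [T0] rise at the rate [mu] of their index, the other tied points rise no
    faster, and the untied ones start strictly lower. *)
Lemma tie_perturb xi u (mu : 'I_s -> R) (T0 : {set Q}) : T0 \subset tie xi ->
  (forall q, q \in T0 -> dot u (pt q) = mu (idx q)) ->
  (forall q, q \in tie xi -> dot u (pt q) <= mu (idx q)) ->
  exists2 e, 0 < e & forall t, 0 <= t <= e -> T0 \subset tie (xi + t *: u).
Proof.
move=> /fintype.subsetP T0T uT0 uT.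
(* [lam q] is the maximum for the index of [q], read off [T0]; the last branch is a default for
   indices that [T0] misses. *)
pose lam (q : Q) := if [pick q' in T0 | idx q' == idx q] is Some q'
  then height xi q' else height xi q + 1.
have lamE q q' : q' \in T0 -> idx q' = idx q -> lam q = height xi q'.
  move=> q'T e; rewrite /lam; case: pickP => [q0 /andP[q0T /eqP q0q]|/(_ q')].
    by apply: height_tie; rewrite ?q0q// T0T.
  by rewrite q'T e eqxx.
have [e e0 eP] := @finite_slack (fun q => lam q - height xi q)
  (fun q => dot u (pt q) - mu (idx q)) (fun q => height xi q < lam q)
  (fun q hq => etrans (subr_gt0 _ _) hq).
exists e => // t te; apply/fintype.subsetP => q qT0; apply/tieP => q' q'q.
rewrite !height_line (uT0 _ qT0).
have lq' : lam q' = height xi q by apply: lamE.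
have hq' : height xi q' <= height xi q by move: (T0T _ qT0) => /tieP; exact.
have [q'T|q'T] := boolP (q' \in tie xi).
  apply: lerD => //; rewrite ler_wpM2l//; first by case/andP: te.
  by rewrite -q'q uT.
have lt : height xi q' < lam q'.
  rewrite lq' lt_neqAle hq' andbT; apply: contra q'T => /eqP e'.
  apply/tieP => q2 q2q'; rewrite e'; move: (T0T _ qT0) => /tieP; apply.
  by rewrite q2q'.
by have := eP t q' te lt; rewrite lq' q'q; lra.
Qed.

Definition ties_indep : Prop := forall xi, indep idx pt (tie xi).

(** The inequality asks for at least as many forms as unknowns: [s] multipliers and the coordinates
    of [c] left free by [D]. *)
Definition in_general_position (p : 'rV[R]_n) (V : 'M[R]_n) : Prop :=
  forall (T : {set Q}) (D : {set 'I_n.+1}),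
    indep idx pt T -> coverI idx T -> (#|~: D| + s <= #|T|)%N ->
    nondegenerate idx pt h (col_mx p V) T D.

(** Only finitely many pairs [(T, D)] occur; each imposes an open dense condition, the whole space
    when its hypotheses fail. *)
Lemma in_general_position_generic : exists2 U : set ('rV[R]_n * 'M[R]_n),
  generic U & forall p V, U (p, V) -> in_general_position p V.
Proof.
pose good (TD : {set Q} * {set 'I_n.+1}) := [/\ indep idx pt TD.1, coverI idx TD.1
  & (#|~: TD.2| + s <= #|TD.1|)%N].
have [|U gU UP] := @generic_finite _ ({set Q} * {set 'I_n.+1})%type
  (fun TD => [set pV : 'rV[R]_n * 'M[R]_n | good TD ->
     nondegenerate idx pt h (col_mx pV.1 pV.2) TD.1 TD.2]).
  move=> TD; have [[iT cT cardT]|ngood] := pselect (good TD).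
    rewrite (_ : [set _ | _] = [set pV : 'rV[R]_n * 'M[R]_n |
      nondegenerate idx pt h (col_mx pV.1 pV.2) TD.1 TD.2]).
      exact: nondegenerate_generic.
    by apply/seteqP; split=> pV /=; [apply|].
  rewrite (_ : [set _ | _] = [set: 'rV[R]_n * 'M[R]_n]); first exact: generic_setT.
  by apply/seteqP; split.
by exists U => // p V UpV T D iT cT cardT; apply: (UP _ UpV (T, D)).
Qed.

(** * Dimension counts on the members of a generic flag *)

Section Flag.
Variables (p : 'rV[R]_n) (V : 'M[R]_n).
Hypothesis gpV : in_general_position p V.

Definition supp_lt (d : nat) (c : 'rV[R]_n) : Prop :=
  forall k : 'I_n, (d <= k)%N -> c 0 k = 0.

Lemma form_homog (t : R) (c : 'rV[R]_n) mu q :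
  form idx pt h (col_mx p V) mu (row_mx t%:M c) q =
  dot (t *: p + c *m V) (pt q) - t * h q - mu 0 (idx q).
Proof.
rewrite /form; have -> : row_mx (t%:M : 'rV[R]_1) c *m col_mx p V = t *: p + c *m V.
  by rewrite (mul_row_col (t%:M : 'M[R]_(1, 1))) mul_scalar_mx.
have -> // : row_mx (t%:M : 'rV[R]_1) c 0 0 = t.
have -> : (0 : 'I_(1 + n)) = lshift n 0 by apply: val_inj.
by rewrite row_mxEl mxE.
Qed.

Lemma card_ord_gt m d : (d < m)%N -> #|[set k : 'I_m | (d < k)%N]%SET| = (m - d.+1)%N.
Proof.
move=> dm; rewrite -sum1dep_card -(big_geq_mkord _ _ predT (fun=> 1%N)).
by rewrite sum_nat_const_nat muln1.
Qed.

Lemma row_mx_tail (t : R) (c : 'rV[R]_n) d (k : 'I_n.+1) : supp_lt d c -> (d < k)%N ->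
  (row_mx (t%:M : 'rV[R]_1) c : 'rV[R]_(n.+1)) 0 k = 0.
Proof.
move=> cd; case: (@fintype.split_ordP 1 n k) => j ->.
  by rewrite (ord1 j).
move=> dj; apply: (etrans (@row_mxEr R 1 1 n t%:M c 0 j)).
by apply: cd; rewrite -ltnS.
Qed.

Lemma row_mx_head (t : R) (c : 'rV[R]_n) :
  (row_mx (t%:M : 'rV[R]_1) c : 'rV[R]_(n.+1)) 0 0 = t.
Proof.
have -> : (0 : 'I_(1 + n)) = lshift n 0 by apply: val_inj.
by apply: (etrans (@row_mxEl R 1 1 n t%:M c 0 0)); rewrite mxE.
Qed.

(** More than [s + d] ties would form a nondegenerate system in [s + d + 1] unknowns, yet the maxima
    together with [(1, c)] solve it nontrivially. *)
Lemma card_tie_flag d xi : ties_indep -> (d <= n)%N -> coverI idx (tie xi) ->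
  flag p V d xi -> (#|tie xi| <= s + d)%N.
Proof.
move=> tind dn cT [c [cd xiE]]; rewrite leqNgt; apply/negP => ltT.
have /(gpV (tind xi) cT) nd : (#|~: [set k : 'I_n.+1 | (d < k)%N]%SET| + s <= #|tie xi|)%N.
  have := cardsC [set k : 'I_n.+1 | (d < k)%N]%SET.
  by rewrite card_ord_gt ?ltnS// card_ord; lia.
have /boolp.choice[q0 /all_and2[q0T q0i]] := cT.
have [] := nd (\row_i height xi (q0 i)) (row_mx 1%:M c).
- by move=> k; rewrite inE; exact: row_mx_tail.
- move=> q qT; rewrite form_homog scale1r -xiE mul1r mxE.
  by rewrite (height_tie (q0T _) qT) ?q0i// subrr.
- by move=> _ /matrixP/(_ 0 0)/eqP; rewrite row_mx_head mxE oner_eq0.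
Qed.

Lemma card_setC_dir d : (d <= n)%N ->
  #|~: ([set k : 'I_n.+1 | (d < k)%N] :|: [set ord0])%SET| = d.
Proof.
move=> dn; have := cardsC ([set k : 'I_n.+1 | (d < k)%N] :|: [set ord0])%SET.
rewrite cardsU cards1 card_ord_gt ?ltnS// card_ord.
rewrite (_ : _ :&: _ = finset.set0)%SET ?cards0; first lia.
by apply/setP => k; rewrite !inE; apply/negbTE/andP => -[dk /eqP k0]; rewrite k0 in dk.
Qed.

(** Adding the homogenizing coordinate to [D] restricts to directions of F_d and leaves [s + d]
    unknowns for at least as many forms. *)
Lemma dir_inj (T : {set Q}) d c (mu : 'I_s -> R) : (d <= n)%N ->
  indep idx pt T -> coverI idx T -> (s + d <= #|T|)%N -> supp_lt d c ->
  (forall q, q \in T -> dot (c *m V) (pt q) = mu (idx q)) -> c = 0.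
Proof.
move=> dn iT cT cardT cd cmu.
have /(gpV iT cT) nd : (#|~: ([set k : 'I_n.+1 | (d < k)%N] :|: [set ord0])%SET| + s <= #|T|)%N.
  by rewrite card_setC_dir// addnC.
have [] := nd (\row_i mu i) (row_mx 0%:M c).
- move=> k; rewrite !inE => /orP[|/eqP ->]; first exact: row_mx_tail.
  exact: row_mx_head.
- by move=> q qT; rewrite form_homog scale0r add0r mul0r subr0 mxE cmu ?subrr.
- move=> _ /(congr1 (@rsubmx R 1 1 n)); rewrite row_mxKr => ->.
  by apply/matrixP => i k; rewrite !mxE.
Qed.

(** Exactly [s + d] forms make the system on directions of F_d square. *)
Lemma dir_surj (T : {set Q}) d (y : Q -> R) : (d <= n)%N ->
  indep idx pt T -> coverI idx T -> #|T| = (s + d)%N ->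
  exists c (mu : 'I_s -> R), supp_lt d c /\
    forall q, q \in T -> dot (c *m V) (pt q) - mu (idx q) = y q.
Proof.
move=> dn iT cT cardT.
have cardD := card_setC_dir dn.
have /(gpV iT cT) nd : (#|~: ([set k : 'I_n.+1 | (d < k)%N] :|: [set ord0])%SET| + s <= #|T|)%N.
  by rewrite cardD addnC cardT.
have [|mu [c [cD cT']]] := nondegenerate_surj nd _ y.
  have := cardsC ([set k : 'I_n.+1 | (d < k)%N] :|: [set ord0])%SET.
  by rewrite cardD card_ord cardT => e; rewrite -addnA; congr (_ + _)%N; rewrite addnC.
pose c0 := lsubmx (c : 'rV[R]_(1 + n)); pose c1 := rsubmx (c : 'rV[R]_(1 + n)).
have c00 : c0 = (0 : R)%:M.
  apply/matrixP => i j; rewrite !ord1 !mxE mul0rn; apply: etrans (cD ord0 _).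
    by congr (c _ _); apply: val_inj.
  by rewrite !inE eqxx orbT.
exists c1, (fun i => mu 0 i); split=> [k dk|q qT].
  rewrite mxE; apply: (cD (rshift 1 k)).
  by rewrite !inE /= add1n ltnS dk.
by rewrite -(cT' _ qT) -[c](@hsubmxK _ 1 1 n) -/c0 -/c1 c00 form_homog scale0r add0r mul0r subr0.
Qed.

End Flag.
End Arrangement.

(** * Local structure of the curves *)
Section LocalStructure.
Variables (R : realType) (n s : nat) (Q : finType).
Variables (idx : Q -> 'I_s) (pt : Q -> 'rV[R]_n) (h : Q -> R).
Variables (p : 'rV[R]_n) (V : 'M[R]_n).
Hypothesis gpV : in_general_position idx pt h p V.
Hypothesis uV : V \in unitmx.
Hypothesis tind : ties_indep idx pt h.
Variables (d : nat) (dn : (d < n)%N) (k : 'I_s -> nat).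
Hypothesis sumk : (\sum_i k i)%N = d.

Local Notation tie := (tie idx pt h).
Local Notation fib := (fib idx).
Local Notation od := (Ordinal dn).

Definition meets_bounds (T : {set Q}) : Prop := forall i, (k i < fib T i)%N.

(** With [k i] equal to m_i(d) this is X'_{d+1}; the bound in [meets_bounds] is strict because [fib]
    counts m_i(xi) + 1 points. *)
Definition curve : set 'rV[R]_n :=
  [set xi | flag p V d.+1 xi /\ meets_bounds (tie xi)].

(** Since the [k i] sum to [d], such a set has exactly [k i + 1] points of each index [i]: it is a
    minimal set of ties meeting the bounds. *)
Definition edge (T : {set Q}) : Prop := #|T| = (s + d)%N /\ meets_bounds T.

(** Coordinate along the row of [V] that extends the directions of F_d to those of F_{d+1}. *)
Definition slope (u : 'rV[R]_n) : R := (u *m invmx V) 0 od.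

Lemma slope_mul c : slope (c *m V) = c 0 od.
Proof. by rewrite /slope mulmxK. Qed.

Lemma flag_line e xi c t : flag p V e xi -> supp_lt e c -> flag p V e (xi + t *: (c *m V)).
Proof.
move=> [c' [c'e ->]] ce; exists (c' + t *: c); split=> [j je|].
  by rewrite !mxE c'e// ce// mulr0 addr0.
by rewrite mulmxDl scalemxAl addrA.
Qed.

Lemma bounds_coverI T : meets_bounds T -> coverI idx T.
Proof. by move=> bT; apply: fib_coverI => i; exact: leq_ltn_trans (bT i). Qed.

Lemma bounds_card T : meets_bounds T -> (s + d <= #|T|)%N.
Proof.
move=> bT; rewrite -(sum_fib idx) -sumk -[X in (X + _)%N](card_ord s) -sum1_card.
by rewrite -big_split leq_sum//= => i _; rewrite add1n.
Qed.

Lemma curve_card xi : curve xi -> #|tie xi| = (s + d)%N \/ #|tie xi| = (s + d.+1)%N.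
Proof.
move=> [fxi bT]; have := bounds_card bT.
have := card_tie_flag gpV tind dn (bounds_coverI bT) fxi; lia.
Qed.

Lemma excess (T : {set Q}) : meets_bounds T -> #|T| = (s + d.+1)%N ->
  exists j, ((k j).+1 < fib T j)%N.
Proof.
move=> bT cT; apply: contrapT => nj.
have : (#|T| <= s + d)%N; last by rewrite cT; lia.
rewrite -(sum_fib idx) -sumk -[X in (X + _)%N](card_ord s) -sum1_card -big_split.
rewrite leq_sum//= => i _; rewrite add1n leqNgt; apply/negP => ki; apply: nj.
by exists i.
Qed.

Lemma edge_setD1 (T : {set Q}) q : meets_bounds T -> #|T| = (s + d.+1)%N -> q \in T ->
  ((k (idx q)).+1 < fib T (idx q))%N -> edge (T :\ q).
Proof.
move=> bT cT qT kq; split.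
  by have := cardsD1 q T; rewrite qT cT; lia.
move=> i; have := fib_setD1 idx i qT; have := bT i.
by have [<-|] := eqVneq (idx q) i => /=; move: kq; lia.
Qed.

Lemma exists_edge xi : curve xi -> exists2 T0, edge T0 & T0 \subset tie xi.
Proof.
move=> Cxi; case: (Cxi) => fxi bT; have [cT|cT] := curve_card Cxi.
  by exists (tie xi).
have [j kj] := excess bT cT.
have /card_gt0P[q] : (0 < fib (tie xi) j)%N by exact: leq_ltn_trans kj.
rewrite inE => /andP[qT /eqP qj]; exists (tie xi :\ q); last exact: subsetDl.
by apply: edge_setD1; rewrite ?qj.
Qed.

Lemma edge_inj (T : {set Q}) c (mu : 'I_s -> R) : edge T -> indep idx pt T ->
  supp_lt d c -> (forall q, q \in T -> dot (c *m V) (pt q) = mu (idx q)) -> c = 0.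
Proof.
move=> [cT bT] iT; apply: (dir_inj gpV) => //; first exact: ltnW.
  exact: bounds_coverI.
by rewrite cT.
Qed.

Lemma supp_lt_od (c : 'rV[R]_n) : supp_lt d.+1 c -> c 0 od = 0 -> supp_lt d c.
Proof.
move=> cd c0 j; rewrite leq_eqVlt => /orP[/eqP dj|]; last exact: cd.
by rewrite -c0; congr (c 0 _); apply: val_inj.
Qed.

Lemma edge_line (T : {set Q}) : edge T -> indep idx pt T ->
  exists (c : 'rV[R]_n) (mu : 'I_s -> R), [/\ supp_lt d.+1 c, c 0 od = 1 &
    forall q, q \in T -> dot (c *m V) (pt q) = mu (idx q)].
Proof.
move=> [cT bT] iT.
(* A direction of F_d corrects the new row of [V] until its pairing with the points of [T] depends
   only on their index. *)
have [c [mu [cd cmu]]] := dir_surj gpV (fun q => - dot (row od V) (pt q))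
  (ltnW dn) iT (bounds_coverI bT) cT.
exists (c + delta_mx 0 od), mu; split.
- move=> j dj; rewrite !mxE cd ?(ltnW dj)//= add0r.
  by rewrite -val_eqE /= gtn_eqF.
- by rewrite !mxE cd//= !eqxx add0r.
- move=> q qT; rewrite mulmxDl dotDl -rowE.
  by have := cmu q qT; lra.
Qed.

(** Some edge stays tied along [c], and no other tied point overtakes it. *)
Definition admissible (xi c : 'rV[R]_n) : Prop := supp_lt d.+1 c /\
  exists (T0 : {set Q}) (mu : 'I_s -> R), [/\ edge T0, T0 \subset tie xi,
    (forall q, q \in T0 -> dot (c *m V) (pt q) = mu (idx q)) &
    (forall q, q \in tie xi -> dot (c *m V) (pt q) <= mu (idx q))].

Lemma admissible_curve xi c : curve xi -> admissible xi c ->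
  exists2 e, 0 < e & forall t, 0 <= t <= e -> curve (xi + t *: (c *m V)).
Proof.
move=> [fxi bT] [cd [T0 [mu [eT0 T0T zT0 leT]]]].
have [e e0 eP] := tie_perturb T0T zT0 leT.
exists e => // t /eP T0t; split; first exact: flag_line.
by move=> i; apply: leq_trans (fibS idx i T0t); case: eT0.
Qed.

(** When the tied set is itself an edge, the direction keeping all its ties can be followed both
    ways. *)
Lemma edge_admissible xi : curve xi -> #|tie xi| = (s + d)%N ->
  exists c : 'rV[R]_n, [/\ c 0 od = 1, admissible xi c & admissible xi (- c)].
Proof.
move=> [fxi bT] cT; have eT : edge (tie xi) by [].
have [c [mu [cd c1 cmu]]] := edge_line eT (tind xi).
exists c; split=> //; split=> //.
- by exists (tie xi), mu; split=> // q /cmu ->.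
- by move=> j dj; rewrite mxE cd// oppr0.
- exists (tie xi), (fun i => - mu i); split=> // q qT.
    by rewrite mulNmx dotNl cmu.
  by rewrite mulNmx dotNl cmu.
Qed.

(* The directions [c q] leaving a vertex along its edges, normalized so that the
   form of [q] drops at unit speed, add up to [0]: the sum is annihilated by all
   the forms tied at the vertex.  This is the balancing condition. *)
Lemma vertex_balanced xi : curve xi -> #|tie xi| = (s + d.+1)%N ->
  exists (P : pred Q) (c : Q -> 'rV[R]_n), [/\ exists q, P q,
    (forall q, P q -> admissible xi (c q) /\ c q 0 od != 0) &
    \sum_(q | P q) c q = 0].
Proof.
move=> [fxi bT] cT; have [j kj] := excess bT cT.
have covT := bounds_coverI bT.
(* For tied [q], the pairs [(c q, mu q)] are the dual basis of the tied forms, up to sign. *)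
have /boolp.choice[c /boolp.choice[mu cmu]] : forall q, exists (c : 'rV[R]_n) (mu : 'I_s -> R),
    supp_lt d.+1 c /\ forall q', q' \in tie xi ->
      dot (c *m V) (pt q') - mu (idx q') = - (q' == q)%:R.
  by move=> q; exact: (dir_surj gpV).
exists (fun q => (q \in tie xi) && (idx q == j)), c; split.
- have [q [qT qj]] := covT j; by exists q; rewrite qT qj eqxx.
- move=> q /andP[qT /eqP qj]; have [cd cq] := cmu q.
  have eq0 q' : q' \in tie xi :\ q -> dot (c q *m V) (pt q') = mu q (idx q').
    rewrite in_setD1 => /andP[/negbTE q'q q'T]; have := cq _ q'T.
    by rewrite q'q oppr0 => /eqP; rewrite subr_eq0 => /eqP.
  have eTq : edge (tie xi :\ q) by apply: edge_setD1; rewrite ?qj.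
  split.
    split=> //; exists (tie xi :\ q), (mu q); split=> //; first exact: subsetDl.
    by move=> q' q'T; rewrite -subr_le0 cq// oppr_le0 ler0n.
  (* With zero slope [c q] would be a direction of F_d, hence 0 by [edge_inj]. Another tied point of
     index [j] then gives [mu q j = 0], against the value -1 at [q]. *)
  apply/eqP => c0; have := edge_inj eTq (indepS (subsetDl _ _) (tind xi))
    (supp_lt_od cd c0) eq0.
  move=> cq0; have := cq _ qT; rewrite cq0 mul0mx dot0l eqxx sub0r.
  have [q' [q'T q'j]] := bounds_coverI (proj2 eTq) j.
  have := eq0 _ q'T; rewrite cq0 mul0mx dot0l q'j qj => <- /eqP; rewrite oppr0 eq_sym oppr_eq0 oner_eq0 //.
(* At a tied point of index [j] exactly one summand contributes -1, elsewhere none: the defect is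
   absorbed by the multiplier of [j], and injectivity kills the sum. *)
- apply: (dir_inj gpV dn (tind xi) covT (mu := fun i =>
    \sum_(q | (q \in tie xi) && (idx q == j)) mu q i - (i == j)%:R)).
  + by rewrite cT.
  + by move=> a da; rewrite summxE big1// => q _; have [-> //] := cmu q.
  + move=> q' q'T; rewrite mulmx_suml dot_suml.
    rewrite (eq_bigr (fun q => mu q (idx q') - (q' == q)%:R)); last first.
      by move=> q _; have [_ /(_ _ q'T)/eqP] := cmu q; rewrite subr_eq addrC => /eqP.
    rewrite sumrB; congr (_ - _); have [q'j|q'j] := eqVneq (idx q') j.
      rewrite (bigD1 q')/= ?q'T ?q'j ?eqxx//= big1 ?addr0// => q /andP[_ qq'].
      by rewrite eq_sym (negbTE qq').
    rewrite big1// => q /andP[_ /eqP qj]; case: eqP => // e.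
    by rewrite e qj eqxx in q'j.
Qed.

(** At a vertex the nonzero slopes of the edges add up to zero, so both signs occur. *)
Lemma curve_both_ways xi : curve xi ->
  (exists c : 'rV[R]_n, c 0 od < 0 /\ admissible xi c) /\ (exists c : 'rV[R]_n, 0 < c 0 od /\ admissible xi c).
Proof.
move=> Cxi; have [cT|cT] := curve_card Cxi.
  have [c [c1 ac aNc]] := edge_admissible Cxi cT; split.
    by exists (- c); split=> //; rewrite mxE c1 oppr_lt0.
  by exists c; rewrite c1.
have [P [c [[q Pq] cP c0]]] := vertex_balanced Cxi cT.
have sum0 : \sum_(q | P q) c q 0 od = 0 by rewrite -summxE c0 mxE.
have sumN0 : \sum_(q | P q) - c q 0 od = 0 by rewrite sumrN sum0 oppr0.
split; apply: contrapT => nc; have [_ /eqP] := cP _ Pq; apply.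
  apply: (psumr_eq0P _ sum0) => // q' Pq'; rewrite leNgt; apply/negP => lt0.
  by apply: nc; exists (c q'); split=> //; case: (cP _ Pq').
apply/eqP; rewrite -oppr_eq0; apply/eqP.
apply: (psumr_eq0P _ sumN0) => // q' Pq'; rewrite oppr_ge0 leNgt; apply/negP => lt0.
by apply: nc; exists (c q'); split=> //; case: (cP _ Pq').
Qed.

(** At a vertex one tied point lies outside [T0]; the direction makes it drop at unit speed while
    [T0] stays tied. *)
Lemma edge_dir xi (T0 : {set Q}) : curve xi -> edge T0 -> T0 \subset tie xi ->
  exists (c : 'rV[R]_n) (mu : 'I_s -> R), [/\ supp_lt d.+1 c, c 0 od != 0,
    (forall q, q \in T0 -> dot (c *m V) (pt q) = mu (idx q)) &
    (forall q, q \in tie xi -> dot (c *m V) (pt q) <= mu (idx q))].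
Proof.
move=> Cxi eT0 T0T; have [cT0 _] := eT0; have [cT|cT] := curve_card Cxi.
  have <- : T0 = tie xi by apply/eqP; rewrite eqEcard T0T cT cT0 leqnn.
  have [c [mu [cd c1 cmu]]] := edge_line eT0 (indepS T0T (tind xi)).
  by exists c, mu; split=> [//||//|q /cmu->//]; rewrite c1 oner_neq0.
have [c [mu [cd cmu]]] := dir_surj gpV (fun q => - (q \notin T0)%:R) dn (tind xi)
  (bounds_coverI (proj2 Cxi)) cT.
have zT0 q : q \in T0 -> dot (c *m V) (pt q) = mu (idx q).
  move=> qT0; have := cmu q (fintype.subsetP T0T _ qT0).
  by rewrite qT0 oppr0 => /eqP; rewrite subr_eq0 => /eqP.
exists c, mu; split=> //; last first.
  by move=> q qT; rewrite -subr_le0 cmu// oppr_le0 ler0n.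
apply/eqP => c0.
have cz := edge_inj eT0 (indepS T0T (tind xi)) (supp_lt_od cd c0) zT0.
have [q qT qT0] : exists2 q, q \in tie xi & q \notin T0.
  have /card_gt0P[q] : (0 < #|tie xi :\: T0|)%N.
    by rewrite cardsD (finset.setIidPr T0T) cT cT0; lia.
  by rewrite inE => /andP[]; exists q.
have := cmu q qT; rewrite cz mul0mx dot0l qT0 sub0r.
have [q' [q'T q'q]] := bounds_coverI (proj2 eT0) (idx q).
have := zT0 _ q'T; rewrite cz mul0mx dot0l q'q => <- /eqP; rewrite oppr0 eq_sym oppr_eq0 oner_eq0 //.
Qed.

Definition edge_cell (T : {set Q}) : set 'rV[R]_n :=
  [set xi | flag p V d.+1 xi /\ T \subset tie xi].

Lemma edge_cell_curve T : edge T -> edge_cell T `<=` curve.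
Proof.
move=> [_ bT] xi [fxi TT]; split=> // i; apply: leq_trans (fibS idx i TT).
exact: bT.
Qed.

Definition edge_times (T : {set Q}) xi u : set R := [set t | T \subset tie (xi + t *: u)].

Lemma edge_timesP (T : {set Q}) xi u t : edge_times T xi u t <->
  forall qq : Q * Q, qq.1 \in T -> idx qq.2 = idx qq.1 ->
    (height pt h xi qq.2 - height pt h xi qq.1) +
      t * (dot u (pt qq.2) - dot u (pt qq.1)) <= 0.
Proof.
rewrite /edge_times /=; split=> [/fintype.subsetP TT [q q'] /= qT qq'|H].
  by have /tieP/(_ q' qq') := TT _ qT; rewrite !height_line; lra.
apply/fintype.subsetP => q qT; apply/tieP => q' qq'; rewrite !height_line.
by have := H (q, q') qT qq' => /=; lra.
Qed.

Lemma edge_times_closed (T : {set Q}) (xi u : 'rV[R]_n) : closed (edge_times T xi u).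
Proof.
rewrite (_ : edge_times T xi u = \bigcap_(qq in
    [set qq : Q * Q | qq.1 \in T /\ idx qq.2 = idx qq.1])
    (fun t : R => (height pt h xi qq.2 - height pt h xi qq.1) +
      t * (dot u (pt qq.2) - dot u (pt qq.1))) @^-1` [set x | x <= 0]); last first.
  apply/seteqP; split=> t; first by move=> /edge_timesP H qq [qT qq']; exact: H.
  by move=> H; apply/edge_timesP => qq qT qq'; apply: H.
apply: closed_bigI => qq _; apply: closed_comp; last exact: closed_le.
move=> t _; apply: cvgD; first exact: cvg_cst.
by apply: cvgMr_tmp; exact: cvg_id.
Qed.

Lemma edge_times_itv (T : {set Q}) (xi u : 'rV[R]_n) : is_interval (edge_times T xi u).
Proof.
move=> a b /edge_timesP Ia /edge_timesP Ib t /andP[at_ tb]; apply/edge_timesP.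
move=> qq qT qq'; have := Ia qq qT qq'; have := Ib qq qT qq'.
move: (_ - _) (_ - _) => B A; case: (leP 0 B) => B0.
  by have : t * B <= b * B; [exact: ler_wpM2r|lra].
by have : t * B <= a * B; [apply: ler_wnM2r => //; exact: ltW|lra].
Qed.

(** A nonempty cell lies on one line, where it is a closed interval; [tie_perturb] supplies a second
    point. *)
Lemma edge_cell_finite_union T : edge T -> finite_union_segs_halflines (edge_cell T).
Proof.
move=> eT; have [[xi0 PT]|empty] := pselect (edge_cell T !=set0); last first.
  rewrite (_ : edge_cell T = set0); first exact: finite_union0.
  by apply/seteqP; split=> // xi PT; apply: empty; exists xi.
case: (PT) => f0 T0.
have [c [mu [cd c0 zT leT]]] := edge_dir (edge_cell_curve eT PT) eT T0.
have [e e0 eP] := tie_perturb T0 zT leT.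
have iT := indepS T0 (tind xi0).
rewrite (_ : edge_cell T = [set xi0 + t *: (c *m V) | t in edge_times T xi0 (c *m V)]).
  apply: (@itv_finite_union _ _ _ _ _ 0 e) => //.
  - exact: edge_times_closed.
  - exact: edge_times_itv.
  - by apply: eP; rewrite lexx ltW.
  - by apply: eP; rewrite lexx ltW.
  - by apply: contra c0 => /eqP cV; rewrite -slope_mul cV /slope mul0mx mxE.
apply/seteqP; split=> xi; last first.
  by move=> [t It <-]; split; [exact: flag_line|].
move=> [[c1 [c1d ->]] TT]; case: f0 => [c2 [c2d xi0E]].
(* [t] is chosen to cancel the slope; what remains is a direction of F_d keeping [T] tied, hence
   0. *)
pose t := (c1 0 od - c2 0 od) / c 0 od.
have diff0 : c1 - c2 - t *: c = 0.
  have zdiff q : q \in T -> dot ((c1 - c2) *m V) (pt q) =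
      height pt h (p + c1 *m V) q - height pt h xi0 q.
    by move=> _; rewrite mulmxBl dotBl /height xi0E !dotDl; lra.
  have /boolp.choice[q0 /all_and2[q0T q0i]] := bounds_coverI (proj2 eT).
  apply: (edge_inj eT iT (mu := fun i => height pt h (p + c1 *m V) (q0 i)
    - height pt h xi0 (q0 i) - t * mu i)).
    apply: supp_lt_od; last by rewrite !mxE /t divfK// subrr.
    by move=> j dj; rewrite !mxE c1d// c2d// cd// mulr0 !subr0.
  move=> q qT; rewrite [(_ - _) *m V]mulmxBl dotBl zdiff// -scalemxAl dotZl zT//.
  have tieq xi' : T \subset tie xi' -> height pt h xi' (q0 (idx q)) = height pt h xi' q.
    by move=> /fintype.subsetP sT; apply: (height_tie (idx := idx)); rewrite ?sT ?q0i.
  by rewrite !tieq.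
have xiE : p + c1 *m V = xi0 + t *: (c *m V).
  rewrite xi0E -addrA; congr (_ + _); rewrite scalemxAl -mulmxDl; congr (_ *m _).
  by move/eqP: diff0; rewrite -addrA -opprD subr_eq0 => /eqP.
by exists t => //; rewrite /edge_times /= -xiE.
Qed.

Lemma curve_finite_union : finite_union_segs_halflines curve.
Proof.
rewrite (_ : curve = [set xi | exists T : {set Q}, edge T /\ edge_cell T xi]).
  apply: (@finite_union_bigcup _ _ {set Q}
    (fun T => [set xi | edge T /\ edge_cell T xi])) => T.
  have [eT|neT] := pselect (edge T).
    rewrite (_ : [set _ | _] = edge_cell T); first exact: edge_cell_finite_union.
    by apply/seteqP; split=> xi //= -[].
  rewrite (_ : [set _ | _] = set0); first exact: finite_union0.
  by apply/seteqP; split=> xi //= -[].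
apply/seteqP; split=> xi; last by move=> [T [eT]]; exact: edge_cell_curve.
move=> Cxi; have [T eT TT] := exists_edge Cxi; exists T; split=> //.
by split=> //; case: Cxi.
Qed.

Lemma curve_component xi : curve xi ->
  exists eta, connected_component curve xi eta /\ flag p V d eta.
Proof.
move=> Cxi.
(* On F_{d+1} the function [slope (x - p)] vanishes exactly on F_d. *)
have [|||eta [ceta leta]] := @component_zero _ _ curve
  (fun x => slope (x - p)) slope xi curve_finite_union _ _ _ Cxi.
- rewrite (_ : (fun x => slope (x - p)) = (fun x : 'rV[R]_n =>
      \sum_j (x 0 j - p 0 j) * invmx V j od)); last first.
    apply/funext => y; rewrite /slope mxE; apply: eq_bigr => j _.
    by rewrite !mxE.
  apply: proj1; apply: regular_sum => j; apply: regularM; last exact: regular_cst.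
  apply: regularD; last exact: regular_cst.
  by apply: linear_regular => [x|x y t]; [exact: coord_continuous|rewrite !mxE].
- move=> x u t; rewrite /slope addrAC mulmxDl mxE -scalemxAl; congr (_ + _).
  by rewrite mxE.
- move=> x Cx; have [[c [lc ac]] [c' [lc' ac']]] := curve_both_ways Cx; split.
    by exists (c *m V); rewrite slope_mul; split=> //; exact: admissible_curve.
  by exists (c' *m V); rewrite slope_mul; split=> //; exact: admissible_curve.
- exists eta; split=> //.
  have [[c [cd etaE]] _] := connected_component_sub ceta.
  exists c; split=> //; apply: supp_lt_od => //.
  by rewrite -leta etaE addrAC subrr add0r slope_mul.
Qed.

(** A point of F_d has at most [s + d] ties, so it is no vertex and the curve continues along both
    [c] and [- c]. *)
Lemma curve_transversal xi : curve xi -> flag p V d xi ->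
  exists q, [/\ piece_ok q, piece_set q `<=` curve & piece_interior q xi].
Proof.
move=> Cxi fxi; have bT := proj2 Cxi.
have cT : #|tie xi| = (s + d)%N.
  apply/eqP; rewrite eqn_leq bounds_card// andbT.
  by apply: (card_tie_flag gpV) => //; [exact: ltnW|exact: bounds_coverI].
have [c [c1 ac aNc]] := edge_admissible Cxi cT.
have [e1 e10 e1P] := admissible_curve Cxi ac.
have [e2 e20 e2P] := admissible_curve Cxi aNc.
have u0 : c *m V != 0.
  by apply/eqP => cV; have := slope_mul c; rewrite cV /slope mul0mx mxE c1 => /eqP;
    rewrite eq_sym oner_eq0.
have E t : xi - e2 *: (c *m V) + t *: (xi + e1 *: (c *m V) - (xi - e2 *: (c *m V))) =
    xi + (t * (e1 + e2) - e2) *: (c *m V).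
  rewrite [_ + _ - _](_ : _ = (e1 + e2) *: (c *m V)); last first.
    by rewrite opprD opprK addrACA subrr add0r scalerDl.
  by rewrite scalerA scalerBl -addrA; congr (_ + _); rewrite addrC.
exists (true, xi - e2 *: (c *m V), xi + e1 *: (c *m V)); split.
- rewrite /piece_ok /= eq_sym -subr_eq0 opprD opprK addrACA subrr add0r -scalerDl.
  by rewrite scaler_eq0 negb_or u0 andbT gt_eqF// addr_gt0.
- move=> z [t /andP[t0 t1] ->] /=; rewrite E.
  have [le0|lt0] := leP 0 (t * (e1 + e2) - e2).
    by apply: e1P; rewrite le0; nra.
  rewrite -[t * (e1 + e2) - e2]opprK scaleNr -scalerN -mulNmx.
  by apply: e2P; apply/andP; split; nra.
- exists (e2 / (e1 + e2)).
    by rewrite divr_gt0 ?addr_gt0//= ltr_pdivrMr ?addr_gt0// mul1r ltrDr.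
  by rewrite /= E divfK ?gt_eqF ?addr_gt0// subrr scale0r addr0.
Qed.

End LocalStructure.

(** * Lifted integer points *)
Section LiftedPoints.
Variables (R : realType) (n s : nat).
Variables (A : 'I_s -> {fset 'rV[int]_n}) (b : 'I_s -> 'rV[int]_n -> R).

(** The disjoint union of the A_i as a finite type, to which the abstract [Q] is specialized. *)
Definition lifted_point : finType := {i : 'I_s & A i}.
Definition lp_pair (q : lifted_point) : 'I_s * 'rV[int]_n := (tag q, val (tagged q)).
Definition lp_idx (q : lifted_point) : 'I_s := (lp_pair q).1.
Definition lp_pt (q : lifted_point) : 'rV[R]_n := realpt R (lp_pair q).2.
Definition lp_height (q : lifted_point) : R := b (lp_pair q).1 (lp_pair q).2.

Local Notation tie := (tie lp_idx lp_pt lp_height).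
Local Notation height := (height lp_pt lp_height).

Lemma lp_pair_inj : injective lp_pair.
Proof.
move=> [i x] [j y] e; have eij : i = j := congr1 fst e.
by case: _ / eij y e => y [/val_inj ->].
Qed.

Lemma height_pairing xi q :
  height xi q = pairing xi (lp_pair q).2 - b (lp_pair q).1 (lp_pair q).2.
Proof. by congr (_ - _); apply: eq_bigr => k _; rewrite mxE. Qed.

Lemma nmax_fib i xi : nmax A b i xi = fib lp_idx (tie xi) i.
Proof.
rewrite /nmax [X in count _ X]enum_fsetE count_map -sum1_count big_enum_cond/= sum1dep_card.
have tagI : injective (fun x : A i => Tagged (fun i => A i) x : lifted_point).
  by move=> x y /eqP; rewrite eq_Tagged => /eqP.
rewrite -(card_imset _ tagI); apply: eq_card => q; apply/imsetP/idP.
  move=> [x]; rewrite inE => /allP Px ->; rewrite inE eqxx andbT.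
  apply/tieP => -[j y] e; have {}e : i = j by rewrite -[LHS]e.
  by case: _ / e y => y; rewrite !height_pairing; exact: (Px _ (valP y)).
rewrite inE => /andP[/tieP qT /eqP]; case: q qT => j x qT e.
have {}e : j = i := e; case: _ / e; exists x => //; rewrite inE; apply/allP => a aA.
have := qT (Tagged (fun i => A i) [` aA]%fset) erefl.
by rewrite !height_pairing.
Qed.

Lemma dot_lift_vec (mu : 'rV[R]_s) (u : 'rV[R]_n) (r : R) q :
  dot (row_mx (row_mx mu u) r%:M) (lift_vec b (lp_pair q)) =
  dot u (lp_pt q) - mu 0 (lp_idx q) + r * lp_height q.
Proof.
rewrite !dot_row_mx dotNr dot_delta [_ + dot u _]addrC; congr (_ + _).
by rewrite /dot big_ord1 !mxE.
Qed.

Lemma span_orthogonal N (X : seq 'rV[R]_N) (x v : 'rV[R]_N) :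
  (forall w, w \in X -> dot w x = 0) -> v \in <<X>>%VS -> dot v x = 0.
Proof.
move=> Xx /(@coord_span _ _ _ (in_tuple X)) ->; rewrite dot_suml big1// => i _.
by rewrite dotZl Xx ?mulr0// mem_nth.
Qed.

Lemma dotC N (u v : 'rV[R]_N) : dot u v = dot v u.
Proof. by apply: eq_bigr => k _; rewrite mulrC. Qed.

(** Free vectors are the rows of a row-free matrix, whose pseudo-inverse solves for arbitrary
    values. *)
Lemma free_dual N (I : eqType) (e : seq I) (f : I -> 'rV[R]_N) (y : I -> R) :
  uniq e -> free (map f e) -> exists z, forall i, i \in e -> dot z (f i) = y i.
Proof.
move=> ue fe; pose X := in_tuple (map f e).
pose M := \matrix_(i < size (map f e)) X`_i.
have fM : row_free M.
  apply: inj_row_free => v vM; apply/matrixP => a i; rewrite ord1 mxE.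
  have /freeP : free X by [].
  apply; rewrite -[RHS]vM mulmx_sum_row; apply: eq_bigr => j _.
  by rewrite rowK.
exists (pinvmx M *m \col_i (map y e)`_i)^T => i ie.
have szi : (index i e < size (map f e))%N by rewrite size_map index_mem.
have -> : f i = row (Ordinal szi) M.
  by rewrite rowK /= (nth_map i) ?index_mem// nth_index.
rewrite dotC; transitivity ((M *m (pinvmx M *m \col_i (map y e)`_i)) (Ordinal szi) 0).
  by rewrite mxE; apply: eq_bigr => k _; rewrite !mxE.
by rewrite mulmxA mulmxVp// mul1mx mxE /= (nth_map i) ?index_mem// nth_index.
Qed.

(** The vector [(lam, xi, -1)] annihilates all lifted vectors tied at [xi] but not the last basis
    vector, so general position makes them free. The same vector then serves to eliminate the
    lifting coordinate. *)
Lemma general_position_ties : general_position A b -> ties_indep lp_idx lp_pt lp_height.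
Proof.
move=> gp xi y; set T := tie xi.
pose lam : 'rV[R]_s := \row_i
  if [pick q in T | lp_idx q == i] is Some q then height xi q else 0.
have lamE q : q \in T -> lam 0 (lp_idx q) = height xi q.
  move=> qT; rewrite mxE; case: pickP => [q' /andP[q'T /eqP q'q]|/(_ q)].
    exact: (height_tie (idx := lp_idx)).
  by rewrite qT eqxx.
pose x : 'rV[R]_(s + n + 1) := row_mx (row_mx lam xi) (-1)%:M.
have xT q : q \in T -> dot x (lift_vec b (lp_pair q)) = 0.
  move=> qT; rewrite dot_lift_vec lamE// mulN1r /height /=; lra.
pose lv q := lift_vec b (lp_pair q).
have spanT (S : seq lifted_point) : {subset S <= T} ->
    last_vec R (s + n) \notin <<[seq lv q | q <- S]>>%VS.
  move=> ST; apply/negP => /(@span_orthogonal _ _ x) H.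
  have : dot (last_vec R (s + n)) x = 0.
    by apply: H => w /mapP[q qS ->]; rewrite dotC xT// ST.
  rewrite /last_vec /x dot_row_mx dotC dot0r add0r /dot big_ord1 !mxE eqxx.
  by rewrite mulr1n mul1r => /eqP; rewrite mulr1n oppr_eq0 oner_eq0.
have freeT (S : seq lifted_point) : uniq S -> {subset S <= T} ->
    (size S <= n + s + 1)%N -> free [seq lv q | q <- S].
  move=> uS ST szS; have [||||] := gp (map lp_pair S).
  - by rewrite map_inj_uniq//; exact: lp_pair_inj.
  - by apply/allP => _ /mapP[q _ ->]; exact: valP.
  - by rewrite size_map.
  - by rewrite -map_comp.
  - by rewrite -map_comp => lS; have := spanT S ST; rewrite lS.
have sT : {subset take (n + s + 1) (enum T) <= T}.
  by move=> q /mem_take; rewrite mem_enum.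
have fT : free [seq lv q | q <- take (n + s + 1) (enum T)].
  by apply: freeT => //; rewrite ?take_uniq ?enum_uniq// size_take; case: ltnP.
(* More than [n + s + 1] ties are impossible: the first [n + s + 1] would be free and span
   everything, including the last basis vector. *)
have [ltT|leT] := ltnP (n + s + 1) (size (enum T)).
  have := spanT _ sT; set X := [seq _ | _ <- _] in fT *.
  suff -> : <<X>>%VS = fullv by rewrite memvf.
  apply/eqP; rewrite eqEdim subvf dimvf /dim/= mul1n.
  move: fT; rewrite /free => /eqP ->; rewrite size_map size_take ltT.
  by rewrite (addnC n s).
rewrite take_oversize// in fT.
have [z zP] := free_dual y (enum_uniq T) fT.
(* Adding this multiple of [x] kills the last coordinate without changing the values on tied
   vectors. *)
pose z' := z + z 0 (rshift (s + n) 0) *: x.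
have z'0 : rsubmx z' = (0 : R)%:M.
  have x1 : x 0 (rshift (s + n) 0) = -1 by rewrite row_mxEr mxE eqxx mulr1n.
  apply/matrixP => i j; rewrite !ord1 mxE [z' _ _]mxE [(_ *: x) _ _]mxE x1.
  by rewrite mulrN1 subrr mxE mul0rn.
exists (fun i => lsubmx (lsubmx z') 0 i), (rsubmx (lsubmx z')) => q qT.
rewrite -(zP q) ?mem_enum//.
transitivity (dot z' (lv q)); last by rewrite dotDl dotZl xT// mulr0 addr0.
rewrite -[z' in RHS]hsubmxK -[lsubmx z' in RHS]hsubmxK z'0 dot_lift_vec mul0r addr0.
by [].
Qed.

End LiftedPoints.

Unset Implicit Arguments.

Theorem theorem2p3 (R : realType) (n s : nat)
  (A : 'I_s -> {fset 'rV[int]_n}) (m : 'I_s -> nat)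
  (b : 'I_s -> 'rV[int]_n -> R) :
  (1 <= n)%N -> (1 <= s <= n)%N ->
  (\sum_(i < s) m i)%N = n ->
  1 <= mixed_volume_mult (fun i => @conv_int R n (A i)) m ->
  general_position A b ->
  (* the good (generic) flags contain an open dense set of flag parameters *)
  exists U : set ('rV[R]_n * 'M[R]_n), open U /\ dense U /\
  forall (p : 'rV[R]_n) (V : 'M[R]_n), U (p, V) -> V \in unitmx ->
  forall md : 'I_s -> nat -> nat,
    (forall i, md i 0%N = 0%N) ->
    (forall i, md i n = m i) ->
    (forall i d, (d < n)%N -> (md i d <= md i d.+1)%N) ->
    (forall d, (d <= n)%N -> (\sum_(i < s) md i d)%N = d) ->
    forall d, (1 <= d <= n)%N ->
      [/\ finite_union_segs_halflines (Xset' A b p V md d),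
          Xset A b p V md d.-1 = Xset' A b p V md d `&` flag p V d.-1,
          (forall xi, Xset' A b p V md d xi ->
             exists eta, connected_component (Xset' A b p V md d) xi eta
                         /\ flag p V d.-1 eta)
        & (forall xi, Xset' A b p V md d xi -> flag p V d.-1 xi ->
             exists q, [/\ piece_ok q, piece_set q `<=` Xset' A b p V md d
                         & piece_interior q xi])].
Proof.
move=> _ _ _ _ gp; have tind := general_position_ties gp.
have [U [oU dU] UP] :=
  in_general_position_generic (@lp_idx n s A) (@lp_pt R n s A) (lp_height b).
(* From here on [d] stands for the former [d - 1]: the curve is X'_{d+1} and is cut by F_d. *)
exists U; split=> //; split=> // p V /UP gpV uV md _ _ _ summd [//|d] /andP[_ dn] /=.
have sumk := summd d (ltnW dn).
have flagS : flag p V d `<=` flag p V d.+1.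
  by move=> xi [c [cd ->]]; exists c; split=> // k /ltnW; exact: cd.
have -> : Xset A b p V md d = Xset' A b p V md d.+1 `&` flag p V d.
  apply/seteqP; split=> xi; last by move=> [[_ bT] fxi].
  by move=> [fxi bT]; split=> //; split=> //; exact: flagS.
have -> : Xset' A b p V md d.+1 =
    curve (@lp_idx n s A) (@lp_pt R n s A) (lp_height b) p V d (md^~ d).
  have boundE i xi : ((md i d)%:Z <= mult A b i xi) =
      (md i d < fib (@lp_idx n s A) (tie (@lp_idx n s A) (@lp_pt R n s A) (lp_height b) xi) i)%N.
    by rewrite /mult nmax_fib lerBrDr -PoszD addn1.
  apply/seteqP; split=> xi [fxi bT]; split=> // i.
    by rewrite -boundE; exact: bT.
  by rewrite boundE; exact: bT.
split.
- exact: (curve_finite_union gpV uV tind dn sumk).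
- by [].
- by move=> xi; exact: (curve_component gpV uV tind dn sumk).
- by move=> xi; exact: (curve_transversal gpV uV tind dn sumk).
Qed.
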